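(* Consider the linear impulsive system $$\dot x_1(t)=A_{11}x_1(t)+A_{12}(t)x_2(t),\quad \dot x_2(t)=A_{21}(t)x_1(t)+A_{22}x_2(t),\quad t\ne\tau_k,$$ $$x_1(t^+)=B_{11}x_1(t)+B_{12}x_2(t),\quad x_2(t^+)=B_{21}x_1(t)+B_{22}x_2(t),\quad t=\tau_k,$$ with constant $A_{ii}\in\mathbb R^{n_i\times n_i}$ and $B_{ij}\in\mathbb R^{n_i\times n_j}$, piecewise continuous $\theta$-periodic $A_{12},A_{21}$, and impulse moments $\tau_k=k\theta$, $k\in\mathbb Z_+$. Let $N\in\mathbb N$ and let $P_0=(P_{ij}^{(0)})_{i,j=1,2}$ be a symmetric positive definite block matrix such that for all $m=0,\dots,N-1$ the matrices $\Pi_m$ (defined in the context) are positive definite. If $$Q:=\sum_{m=0}^{N-1}\frac{\Theta_m(h)}{\lambda_{\min}(\Pi_m)}+\ln\lambda_{\max}(P_N^{-1}B^{T}P_0B)<0,$$ where $h=\theta/N$, $B=(B_{ij})_{i,j=1,2}$, $P_N=(P^{(N)}_{ij})_{i,j=1,2}$, and $P_{ij}^{(m)}$, $\Theta_m(h)$ are defined in the context, then the impulsive system is asymptotically stable.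
   Context: Norms: $\|x\|$ is Euclidean, $\|A\|=\lambda_{\max}^{1/2}(A^TA)$; $\lambda_{\min},\lambda_{\max}$ are the smallest and largest eigenvalues of a matrix with real spectrum. $I_{n}$ is the identity matrix. $x=(x_1^T,x_2^T)^T\in\mathbb R^n$, $n=n_1+n_2$, $x_i\in\mathbb R^{n_i}$; $A_{ij}:\mathbb R\to\mathbb R^{n_i\times n_j}$ for $i\neq j$, with $A_{ij}(t+\theta)=A_{ij}(t)$, $\theta>0$. Solutions are left-continuous at impulse moments; $x(t,t_0,x_0)$ denotes the solution with $x(t_0,t_0,x_0)=x_0$. Stability: the system is stable if for any $\varepsilon>0$, $t_0\in\mathbb R$ there is $\delta=\delta(\varepsilon,t_0)>0$ such that $\|x_0\|<\delta$ implies $\|x(t,t_0,x_0)\|<\varepsilon$ for all $t\ge t_0$; it is asymptotically stable if it is stable and $\lim_{t\to+\infty}\|x(t,t_0,x_0)\|=0$. Constants: $\mu_i,\delta_i,M_i,N_i$ ($i=1,2$) are real constants with $\|e^{sA_{ii}}\|\le M_ie^{s\mu_i}$ and $\|e^{-sA_{ii}}\|\le N_ie^{s\delta_i}$ for all $s\ge0$; the numbers $\mu_1,\mu_2,\delta_1,\delta_2,\mu_2+\delta_1,\mu_1+\delta_2$ are nonzero. $\gamma_{12}^{(m)},\gamma_{21}^{(m)}$ ($m=0,\dots,N-1$) are positive constants with $\sup_{s\in(mh,(m+1)h]}\|A_{12}(s)\|\le\gamma_{12}^{(m)}$, $\sup_{s\in(mh,(m+1)h]}\|A_{21}(s)\|\le\gamma_{21}^{(m)}$.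 Matrices $P^{(m)}_{ij}$: starting from $P^{(0)}_{ij}\in\mathbb R^{n_i\times n_j}$, with $P_{21}^{(m)}=(P_{12}^{(m)})^T$, for $m=0,\dots,N-1$, $$P_{11}^{(m+1)}= e^{-A_{11}^{T}h}\Big(P_{11}^{(m)}-\int_{mh}^{(m+1)h}(P_{12}^{(m)}A_{21}(s)+A_{21}^{T}(s)P_{21}^{(m)})\,ds\Big)e^{-A_{11}h},$$ $$P_{22}^{(m+1)}=e^{-A_{22}^{T}h}\Big(P_{22}^{(m)}-\int_{mh}^{(m+1)h}(A_{12}^{T}(s)P_{12}^{(m)}+P_{21}^{(m)}A_{12}(s))\,ds\Big)e^{-A_{22}h},$$ $$P_{12}^{(m+1)}= e^{-A_{11}^{T}h}\Big(P_{12}^{(m)}-\int_{mh}^{(m+1)h}(P_{11}^{(m)}A_{12}(s)+A_{21}^{T}(s)P_{22}^{(m)})\,ds\Big)e^{-A_{22}h}.$$ Matrices $\Pi_m=(\pi_{ij}^{(m)})_{i,j=1,2}$: $$\pi_{11}^{(m)}=P_{11}^{(m)}-h\big(2\gamma_{21}^{(m)}\|P_{12}^{(m)}\|+\gamma_{12}^{(m)}\|P_{11}^{(m)}\|+\gamma_{21}^{(m)}\|P_{22}^{(m)}\|\big)I_{n_1},$$ $$\pi_{22}^{(m)}=P_{22}^{(m)}-h\big(2\gamma_{12}^{(m)}\|P_{12}^{(m)}\|+\gamma_{12}^{(m)}\|P_{11}^{(m)}\|+\gamma_{21}^{(m)}\|P_{22}^{(m)}\|\big)I_{n_2},$$ $$\pi_{12}^{(m)}=P_{12}^{(m)},\quad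 \pi_{21}^{(m)}=P_{21}^{(m)}.$$ Quantities entering $\Theta_m(h)$: put $q_m=\|P_{11}^{(m)}\|\gamma_{12}^{(m)}+\|P_{22}^{(m)}\|\gamma_{21}^{(m)}$ and $$\eta_{11}^{(m)}=\sqrt{\|P_{11}^{(m)}\|^2+\|P_{12}^{(m)}\|^2}+\|P_{12}^{(m)}\|,\quad \eta_{22}^{(m)}=\sqrt{\|P_{22}^{(m)}\|^2+\|P_{12}^{(m)}\|^2}+\|P_{12}^{(m)}\|,$$ $$\eta_{12}^{(m)}=\tfrac12\Big(q_m+\sqrt{q_m^2+16(\gamma_{21}^{(m)})^2\|P_{12}^{(m)}\|^2}\Big),\quad \eta_{21}^{(m)}=\tfrac12\Big(q_m+\sqrt{q_m^2+16(\gamma_{12}^{(m)})^2\|P_{12}^{(m)}\|^2}\Big),$$ $$\alpha_{11}^{(m)}=\gamma_{12}^{(m)}\|A_{22}\|N_1M_2\eta_{11}^{(m)},\quad \alpha_{12}^{(m)}=\gamma_{12}^{(m)}\|A_{11}\|N_1\eta_{11}^{(m)},$$ $$\alpha_{21}^{(m)}=\gamma_{21}^{(m)}\|A_{11}\|N_2M_1\eta_{22}^{(m)},\quad \alpha_{22}^{(m)}=\gamma_{21}^{(m)}\|A_{22}\|N_2\eta_{22}^{(m)}.$$ Then $$\Theta_m(h)=\frac{\alpha_{11}^{(m)}}{\mu_2}\Big(\frac{e^{(\mu_2+\delta_1)h}-1}{\mu_2+\delta_1}-\frac{e^{\delta_1h}-1}{\delta_1}\Big)+\frac{\alpha_{12}^{(m)}}{\delta_1}\Big(\frac{e^{h\delta_1}-1}{\delta_1}-h\Big)$$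 $$+\frac{\alpha_{21}^{(m)}}{\mu_1}\Big(\frac{e^{(\mu_1+\delta_2)h}-1}{\mu_1+\delta_2}-\frac{e^{\delta_2h}-1}{\delta_2}\Big)+\frac{\alpha_{22}^{(m)}}{\delta_2}\Big(\frac{e^{h\delta_2}-1}{\delta_2}-h\Big)$$ $$+2\Big(\gamma_{12}^{(m)}\eta_{12}^{(m)}N_1M_2\Big(\frac{he^{(\mu_2+\delta_1)h}}{\mu_2+\delta_1}-\frac{e^{(\mu_2+\delta_1)h}-1}{(\mu_2+\delta_1)^2}\Big)+\gamma_{21}^{(m)}\eta_{21}^{(m)}N_2M_1\Big(\frac{he^{(\mu_1+\delta_2)h}}{\mu_1+\delta_2}-\frac{e^{(\mu_1+\delta_2)h}-1}{(\mu_1+\delta_2)^2}\Big)\Big).$$ *)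

(* Defs.v *)
From HB Require Import structures.
From mathcomp Require Import all_boot all_order all_algebra.
From mathcomp Require Import all_classical all_reals all_analysis.

Set Implicit Arguments.
Unset Strict Implicit.
Unset Printing Implicit Defensive.

Import Order.TTheory GRing.Theory Num.Theory.
Import numFieldNormedType.Exports.

Local Open Scope classical_set_scope.
Local Open Scope ring_scope.

(** Matrices with real spectrum have finitely many eigenvalues, at least one
    when [0 < n], so [sup] and [inf] are then attained. *)
Definition lambda_max (R : realType) (n : nat) (A : 'M[R]_n) : R :=
  sup [set a : R | eigenvalue A a].

Definition lambda_min (R : realType) (n : nat) (A : 'M[R]_n) : R :=
  inf [set a : R | eigenvalue A a].

(** The norms [`|x|] and [`|A|] of the library are max-norms, hence the
    Euclidean norm of vectors and the spectral norm of matrices below. *)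
Definition enorm (R : realType) (n : nat) (x : 'cV[R]_n) : R :=
  Num.sqrt (\sum_(i < n) x i ord0 ^+ 2).

Definition opnorm (R : realType) (m n : nat) (A : 'M[R]_(m, n)) : R :=
  Num.sqrt (lambda_max (A^T *m A)).

Definition posdefmx (R : realType) (n : nat) (A : 'M[R]_n) : Prop :=
  A^T = A /\
  forall x : 'cV[R]_n, x != 0 -> 0 < (x^T *m A *m x) ord0 ord0.

Definition expmx (R : realType) (n : nat) (A : 'M[R]_n) : 'M[R]_n :=
  limn (fun k : nat => \sum_(i < k) (i`!%:R)^-1 *: A ^+ i).

(** Entrywise integral over [[a, b]]. *)
Definition intmx (R : realType) (m n : nat) (a b : R)
    (F : R -> 'M[R]_(m, n)) : 'M[R]_(m, n) :=
  \matrix_(i < m, j < n) \int[lebesgue_measure]_(s in `[a, b]) F s i j.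

(** Finitely many discontinuities on each bounded interval, all of the first
    kind; the value at a discontinuity is unconstrained. *)
Definition piecewise_continuous (R : realType) (m n : nat)
    (F : R -> 'M[R]_(m, n)) : Prop :=
  (forall a b : R, finite_set [set t | a <= t <= b /\ ~ {for t, continuous F}])
  /\ forall t : R, cvg (F @ t^'-) /\ cvg (F @ t^'+).

Section Stability.
Context {R : realType} {n : nat}.

(** [sol t0 x0 x] reads "[x] is the solution [t |-> x(t, t0, x0)]"; only the
    values of [x] on [[t0, +oo)] are relevant. *)
Implicit Types sol : R -> 'cV[R]_n -> (R -> 'cV[R]_n) -> Prop.

Definition stable sol : Prop :=
  forall eps t0 : R, 0 < eps ->
  exists2 delta : R, 0 < delta &
    forall x0 x, sol t0 x0 x -> enorm x0 < delta ->
    forall t, t0 <= t -> enorm (x t) < eps.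

Definition asymptotically_stable sol : Prop :=
  stable sol /\
  forall t0 x0 x, sol t0 x0 x -> enorm (x t) @[t --> +oo] --> (0 : R).

End Stability.

Section ImpulsiveSystem.
Context {R : realType} {n1 n2 : nat}.
Variables (A11 : 'M[R]_n1) (A12 : R -> 'M[R]_(n1, n2))
          (A21 : R -> 'M[R]_(n2, n1)) (A22 : 'M[R]_n2).
Variables (B : 'M[R]_(n1 + n2)) (theta : R).

Definition impulse_moment (t : R) : Prop := exists k : nat, t = k%:R * theta.

(** At the discontinuities of [A12] and [A21] the solution is only required to
    be continuous. An impulse at the initial moment is applied. *)
Definition impulsive_solution (t0 : R) (x0 : 'cV[R]_(n1 + n2))
    (x : R -> 'cV[R]_(n1 + n2)) : Prop :=
  [/\ x t0 = x0,
      forall t, t0 < t -> x @ t^'- --> x t,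
      forall t, t0 <= t -> impulse_moment t -> x @ t^'+ --> B *m x t,
      forall t, t0 <= t -> ~ impulse_moment t -> x @ t^'+ --> x t
    & forall t, t0 < t -> ~ impulse_moment t ->
        {for t, continuous A12} -> {for t, continuous A21} ->
        is_derive t 1 x (block_mx A11 (A12 t) (A21 t) A22 *m x t)].

End ImpulsiveSystem.

Section LyapunovMatrices.
Context {R : realType} {n1 n2 : nat}.
Variables (A11 : 'M[R]_n1) (A12 : R -> 'M[R]_(n1, n2))
          (A21 : R -> 'M[R]_(n2, n1)) (A22 : 'M[R]_n2).
Variables (h : R) (P0 : 'M[R]_(n1 + n2)).

(** The step from [P^(m)] to [P^(m+1)]; the (2,1) block of the argument is
    read off as the transpose of the (1,2) block. *)
Definition P_step (m : nat) (P : 'M[R]_(n1 + n2)) : 'M[R]_(n1 + n2) :=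
  let P11 := ulsubmx P in
  let P12 := ursubmx P in
  let P21 := P12^T in
  let P22 := drsubmx P in
  let int k l (F : R -> 'M[R]_(k, l)) := intmx (m%:R * h) (m.+1%:R * h) F in
  let Q11 := expmx (- (h *: A11^T)) *m
    (P11 - int _ _ (fun s => P12 *m A21 s + (A21 s)^T *m P21)) *m
    expmx (- (h *: A11)) in
  let Q22 := expmx (- (h *: A22^T)) *m
    (P22 - int _ _ (fun s => (A12 s)^T *m P12 + P21 *m A12 s)) *m
    expmx (- (h *: A22)) in
  let Q12 := expmx (- (h *: A11^T)) *m
    (P12 - int _ _ (fun s => P11 *m A12 s + (A21 s)^T *m P22)) *m
    expmx (- (h *: A22)) in
  block_mx Q11 Q12 Q12^T Q22.

Fixpoint Pmx (m : nat) : 'M[R]_(n1 + n2) :=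
  if m is m'.+1 then P_step m' (Pmx m') else P0.

End LyapunovMatrices.

Section Estimates.
Context {R : realType} {n1 n2 : nat}.

(** [P], [g12], [g21] stand for [P^(m)], [gamma_12^(m)], [gamma_21^(m)]. *)
Definition Pimx (h g12 g21 : R) (P : 'M[R]_(n1 + n2)) : 'M[R]_(n1 + n2) :=
  let p11 := opnorm (ulsubmx P) in
  let p12 := opnorm (ursubmx P) in
  let p22 := opnorm (drsubmx P) in
  block_mx
    (ulsubmx P - (h * (2 * g21 * p12 + g12 * p11 + g21 * p22))%:M)
    (ursubmx P)
    (dlsubmx P)
    (drsubmx P - (h * (2 * g12 * p12 + g12 * p11 + g21 * p22))%:M).

Definition Theta (A11 : 'M[R]_n1) (A22 : 'M[R]_n2)
    (mu1 mu2 delta1 delta2 M1 M2 N1 N2 h g12 g21 : R)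
    (P : 'M[R]_(n1 + n2)) : R :=
  let p11 := opnorm (ulsubmx P) in
  let p12 := opnorm (ursubmx P) in
  let p22 := opnorm (drsubmx P) in
  let q := p11 * g12 + p22 * g21 in
  let eta11 := Num.sqrt (p11 ^+ 2 + p12 ^+ 2) + p12 in
  let eta22 := Num.sqrt (p22 ^+ 2 + p12 ^+ 2) + p12 in
  let eta12 := 2^-1 * (q + Num.sqrt (q ^+ 2 + 16 * g21 ^+ 2 * p12 ^+ 2)) in
  let eta21 := 2^-1 * (q + Num.sqrt (q ^+ 2 + 16 * g12 ^+ 2 * p12 ^+ 2)) in
  let alpha11 := g12 * opnorm A22 * N1 * M2 * eta11 in
  let alpha12 := g12 * opnorm A11 * N1 * eta11 in
  let alpha21 := g21 * opnorm A11 * N2 * M1 * eta22 in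
  let alpha22 := g21 * opnorm A22 * N2 * eta22 in
  alpha11 / mu2 * ((expR ((mu2 + delta1) * h) - 1) / (mu2 + delta1)
                   - (expR (delta1 * h) - 1) / delta1)
  + alpha12 / delta1 * ((expR (h * delta1) - 1) / delta1 - h)
  + alpha21 / mu1 * ((expR ((mu1 + delta2) * h) - 1) / (mu1 + delta2)
                     - (expR (delta2 * h) - 1) / delta2)
  + alpha22 / delta2 * ((expR (h * delta2) - 1) / delta2 - h)
  + 2 * (g12 * eta12 * N1 * M2 *
           (h * expR ((mu2 + delta1) * h) / (mu2 + delta1)
            - (expR ((mu2 + delta1) * h) - 1) / (mu2 + delta1) ^+ 2)
         + g21 * eta21 * N2 * M1 *
           (h * expR ((mu1 + delta2) * h) / (mu1 + delta2)
            - (expR ((mu1 + delta2) * h) - 1) / (mu1 + delta2) ^+ 2)).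

End Estimates.

(* Main.v *)
Require Import Defs.
From mathcomp Require Import all_boot all_order all_algebra.
From mathcomp Require Import all_classical all_reals all_analysis.
From mathcomp Require Import ring lra.

Set Implicit Arguments.
Unset Strict Implicit.
Unset Printing Implicit Defensive.

Import Order.TTheory GRing.Theory Num.Theory.
Import numFieldNormedType.Exports.

Local Open Scope classical_set_scope.
Local Open Scope ring_scope.

(** The proof is Lyapunov's method with the time-dependent quadratic form
    [x^T P(t) x] that the matrices [P^(m)] discretize.

    On the [m]th subinterval of length [h] the block-diagonal part of the system
    is removed by [y = exp (- r A_diag) x], where [r] is the time elapsed since
    the start of the subinterval. Then [y' = C y], where [C] is the off-diagonal
    part [D] of the system conjugated by [exp (- r A_diag)]. The form
    [v = y^T W y], with [W = P^(m) - J] and [J] the integral of [P^(m) D + D^T P^(m)],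
    starts as [x^T P^(m) x] and, by the definition of the recursion, ends as
    [x^T P^(m+1) x] (lemma [P_stepE]). Its derivative is
    [2 y^T P^(m) (C - D) y - 2 y^T J C y]: the term of order zero in [r] has been
    cancelled by the choice of [J], and what remains tends to [0] with [r]. Bounding
    each term by the largest eigenvalue of a two-by-two quadratic form in the
    norms of the blocks of [y] gives [v' <= theta_rate r * |y|^2], and [Theta] is
    the primitive of [theta_rate] that vanishes at [0] ([is_derive_Theta]). The
    same norm estimate for [J] shows that [W >= Pi_m] throughout the subinterval.
    Hence [|y|^2 <= v / lambda_min Pi_m], and Gronwall's inequality gives the
    growth factor [exp (Theta / lambda_min Pi_m)] ([lyapunov_step]); it also
    follows that every [P^(m)] is positive definite ([next_mx_posdef]).

    The impulse multiplies the form by at most [lambda_max (P_N^-1 B^T P_0 B)],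
    by the variational characterization of that eigenvalue ([lambda_maxP]). Over
    a period the form is thus multiplied by at most [exp Q < 1], and it decays
    geometrically along the impulse moments. Between these, and before the first
    of them, a solution grows at most by a constant factor independent of it
    ([coarse_growth]), which yields stability and attraction together.

    The coefficients may jump at finitely many points of a bounded interval, so
    all comparisons of functions through their derivatives allow a finite
    exceptional set ([nincr_except]). *)

(** * Limits and derivatives of matrix-valued functions *)

Section MatrixLimits.
Context {R : realType} {T : Type} {F : set_system T} {FF : Filter F}.

Lemma cvg_mxP m n (f : T -> 'M[R]_(m, n)) (M : 'M[R]_(m, n)) :
  f @ F --> M <-> forall i j, f x i j @[x --> F] --> M i j.
Proof.
split=> [fM i j|fM].
  exact: (@cvg_comp _ _ _ f (fun N : 'M[R]_(m, n) => N i j) _ _ _ fM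
    (@coord_continuous _ _ _ i j M)).
apply/cvgrPdist_le => /= e e0; near=> x.
rewrite /Num.Def.normr/= mx_normrE (bigmax_le _ (ltW e0))//= => i _.
rewrite !mxE/=; move: i; near: x; apply: filter_forall => /= i.
exact: ((cvgrPdist_le _ _).1 (fM i.1 i.2)).
Unshelve. all: by end_near. Qed.

Lemma cvg_trmx m n (f : T -> 'M[R]_(m, n)) (M : 'M[R]_(m, n)) :
  f @ F --> M -> (f x)^T @[x --> F] --> M^T.
Proof.
move=> /cvg_mxP fM; apply/cvg_mxP => i j; rewrite mxE.
by under eq_fun do rewrite mxE; exact: fM.
Qed.

Lemma cvg_mulmx m n p (f : T -> 'M[R]_(m, n)) (g : T -> 'M[R]_(n, p))
    (M : 'M[R]_(m, n)) (N : 'M[R]_(n, p)) :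
  f @ F --> M -> g @ F --> N -> f x *m g x @[x --> F] --> M *m N.
Proof.
move=> /cvg_mxP fM /cvg_mxP gN; apply/cvg_mxP => i j; rewrite mxE.
under eq_fun do rewrite mxE.
have fgij k : true -> f x i k * g x k j @[x --> F] --> M i k * N k j.
  by move=> _; apply: cvgM.
have addc : continuous (fun z : R * R => z.1 + z.2) by exact: add_continuous.
exact: (cvg_big addc FF fgij).
Qed.

End MatrixLimits.

Section MatrixDerivatives.
Context {R : realType}.
Implicit Types t : R.

Lemma is_derive_mxP m n (f : R -> 'M[R]_(m, n)) t df :
  is_derive t 1 f df <-> forall i j, is_derive t 1 (fun s => f s i j) (df i j).
Proof.
split=> [[fd fE] i j|fd].
  have fd' := (derivable_mxP f t 1).1 fd.
  by apply: DeriveDef => //; rewrite -fE derive_mx// mxE.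
have dfm : derivable f t 1 by apply/derivable_mxP => i j; have [] := fd i j.
apply: DeriveDef => //; rewrite derive_mx//; apply/matrixP => i j; rewrite mxE.
by have [] := fd i j.
Qed.

Lemma is_derive_mulmx m n p (f : R -> 'M[R]_(m, n)) (g : R -> 'M[R]_(n, p))
    t df dg :
  is_derive t 1 f df -> is_derive t 1 g dg ->
  is_derive t 1 (fun s => f s *m g s) (df *m g t + f t *m dg).
Proof.
move=> /is_derive_mxP fd /is_derive_mxP gd; apply/is_derive_mxP => i j.
have -> : (fun s => (f s *m g s) i j) =
    \sum_(k < n) (fun s => f s i k) * (fun s => g s k j).
  by apply/funext => s; rewrite mxE fct_sumE.
rewrite !mxE -big_split/=; apply: is_derive_sum => k.
apply: (is_derive_eq (is_deriveM (fd i k) (gd k j))).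
by rewrite /GRing.scale/=; ring.
Qed.

Lemma is_derive_trmx m n (f : R -> 'M[R]_(m, n)) t df :
  is_derive t 1 f df -> is_derive t 1 (fun s => (f s)^T) df^T.
Proof.
move=> /is_derive_mxP fd; apply/is_derive_mxP => i j; rewrite mxE.
by under eq_fun do rewrite mxE; exact: fd.
Qed.

Lemma is_derive_block_mx m n (a : R -> 'M[R]_m) (d : R -> 'M[R]_n) t da dd :
  is_derive t 1 a da -> is_derive t 1 d dd ->
  is_derive t 1 (fun s => block_mx (a s) 0 0 (d s)) (block_mx da 0 0 dd).
Proof.
move=> /is_derive_mxP ad /is_derive_mxP dd'; apply/is_derive_mxP => i j.
case: (split_ordP i) => i' ->; case: (split_ordP j) => j' ->;
  rewrite ?(block_mxEul, block_mxEur, block_mxEdl, block_mxEdr, mxE);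
  under eq_fun do
    rewrite ?(block_mxEul, block_mxEur, block_mxEdl, block_mxEdr, mxE);
  exact: ad || exact: dd' || exact: is_derive_cst.
Qed.

End MatrixDerivatives.

Section WithinContinuity.
Context {R : realType}.
Implicit Types (A : set R).

Lemma within_mxP m n A (f : R -> 'M[R]_(m, n)) :
  {within A, continuous f} <->
  forall i j, {within A, continuous (fun t => f t i j)}.
Proof.
split=> fc; first by move=> i j t; have /cvg_mxP := fc t; apply.
by move=> t; apply/cvg_mxP => i j; exact: fc.
Qed.

Lemma within_mulmx m n p A (f : R -> 'M[R]_(m, n)) (g : R -> 'M[R]_(n, p)) :
  {within A, continuous f} -> {within A, continuous g} ->
  {within A, continuous (fun t => f t *m g t)}.
Proof. by move=> fc gc t; apply: cvg_mulmx; [exact: fc|exact: gc]. Qed.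

Lemma within_trmx m n A (f : R -> 'M[R]_(m, n)) :
  {within A, continuous f} -> {within A, continuous (fun t => (f t)^T)}.
Proof. by move=> fc t; apply: cvg_trmx; exact: fc. Qed.

Lemma is_derive_within m n A (f df : R -> 'M[R]_(m, n)) :
  (forall t : R, is_derive t 1 f (df t)) -> {within A, continuous f}.
Proof.
move=> fd; apply: continuous_subspaceT => t.
exact/differentiable_continuous/derivable1_diffP.
Qed.

Lemma is_derive_mx_shift m n (f : R -> 'M[R]_(m, n)) (a t : R) df :
  is_derive (t - a) 1 f df -> is_derive t 1 (fun u => f (u - a)) df.
Proof.
move=> /is_derive_mxP fd; apply/is_derive_mxP => i j.
have sd : is_derive t 1 (fun u : R => u - a) 1.
  by apply: is_derive_eq; rewrite subr0.
have := @is_derive1_comp _ (fun u => f u i j) (fun u => u - a) t _ _ (fd i j) sd.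
by rewrite mulr1.
Qed.

End WithinContinuity.

(** * Comparison of real functions through their derivatives *)

Section Comparison.
Context {R : realType}.
Implicit Types (f g v : R -> R) (s : seq R) (a b : R).

(** Split the interval at each exceptional point; between two of them the mean
    value theorem applies. *)
Lemma nincr_except f s a b : a <= b -> {within `[a, b], continuous f} ->
  (forall x, a < x < b -> x \notin s -> exists2 d, is_derive x 1 f d & d <= 0) ->
  f b <= f a.
Proof.
elim: s a b => [|c s IHs] a b ab cf fd.
  have fd' x : x \in `]a, b[ -> exists2 d, is_derive x 1 f d & d <= 0.
    by rewrite in_itv/= => /fd; exact.
  apply: (@ler0_derive1_le_cc _ f a b) => //; rewrite ?in_itv/= ?lexx ?ab//.
  - by move=> x /fd'[d [? ?]].
  - by move=> x /fd'[d fxd d0]; rewrite derive1E (@derive_val _ _ _ _ _ _ _ fxd).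
have [|cab] := boolP (a < c < b); last first.
  apply: IHs => // x xab xs; apply: fd => //; rewrite inE negb_or xs andbT.
  by apply: contraNneq cab => <-.
move=> /andP[ac cb]; apply: (@le_trans _ _ (f c)).
  apply: IHs (ltW cb) _ _.
    by apply: continuous_subspaceW cf; apply: subset_itvr; rewrite bnd_simp ltW.
  move=> x /andP[cx xb] xs; apply: fd; first by rewrite (lt_trans ac) ?xb.
  by rewrite inE negb_or xs gt_eqF.
apply: IHs (ltW ac) _ _.
  by apply: continuous_subspaceW cf; apply: subset_itvl; rewrite bnd_simp ltW.
move=> x /andP[ax xc] xs; apply: fd; first by rewrite ax (lt_trans xc).
by rewrite inE negb_or xs lt_eqF.
Qed.

Lemma ler_except f g s a b : a <= b ->
  {within `[a, b], continuous f} -> {within `[a, b], continuous g} ->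
  (forall x, a < x < b -> x \notin s -> exists d e,
    [/\ is_derive x 1 f d, is_derive x 1 g e & d <= e]) ->
  f b - f a <= g b - g a.
Proof.
move=> ab cf cg fg; suff : (f - g) b <= (f - g) a by rewrite !fctE; lra.
apply: (@nincr_except _ s) => //.
  by move=> x; apply: cvgB; [exact: cf|exact: cg].
move=> x xab xs; have [d [e [fd ge de]]] := fg x xab xs.
by exists (d - e); [exact: is_deriveB|rewrite subr_le0].
Qed.

(** Gronwall's inequality: [v * expR (- g)] is nonincreasing. *)
Lemma gronwall_except v g s a b : a <= b ->
  {within `[a, b], continuous v} -> {within `[a, b], continuous g} ->
  (forall x, a < x < b -> x \notin s -> exists d e,
    [/\ is_derive x 1 v d, is_derive x 1 g e & d <= e * v x]) ->
  v b <= expR (g b - g a) * v a.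
Proof.
move=> ab cv cg vg.
have : (v * (expR \o (- g))) b <= (v * (expR \o (- g))) a.
  apply: (@nincr_except _ s) => //.
    move=> x; apply: cvgM; first exact: cv.
    apply: continuous_cvg; first exact: continuous_expR.
    by apply: cvgN; exact: cg.
  move=> x xab xs; have [d [e [vd ge de]]] := vg x xab xs.
  exists ((d - e * v x) * expR (- g x)); last first.
    by rewrite mulr_le0_ge0 ?expR_ge0// subr_le0.
  have gN := is_deriveN ge.
  have eg := is_derive1_comp (is_derive_expR ((- g) x)) gN.
  apply: (is_derive_eq (is_deriveM vd eg)).
  by rewrite /GRing.scale/= fctE; ring.
rewrite !fctE/= => H.
have := ler_wpM2r (expR_ge0 (g b)) H.
rewrite -!mulrA -!expRD addNr expR0 mulr1 mulrC.
by congr (_ <= expR _ * _); rewrite addrC.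
Qed.

End Comparison.

(** * Euclidean geometry and extremal eigenvalues *)

Section Dot.
Context {R : realType}.

Definition dot n (x y : 'cV[R]_n) : R := (x^T *m y) ord0 ord0.

Implicit Types n : nat.

Lemma dotE n (x y : 'cV[R]_n) : dot x y = \sum_i x i ord0 * y i ord0.
Proof. by rewrite /dot mxE; apply: eq_bigr => i _; rewrite mxE. Qed.

Lemma dotC n (x y : 'cV[R]_n) : dot x y = dot y x.
Proof. by rewrite !dotE; apply: eq_bigr => i _; rewrite mulrC. Qed.

Lemma dotDr n (x y z : 'cV[R]_n) : dot x (y + z) = dot x y + dot x z.
Proof. by rewrite /dot mulmxDr mxE. Qed.

Lemma dotDl n (x y z : 'cV[R]_n) : dot (y + z) x = dot y x + dot z x.
Proof. by rewrite !(dotC _ x) dotDr. Qed.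

Lemma dotZr n a (x y : 'cV[R]_n) : dot x (a *: y) = a * dot x y.
Proof. by rewrite /dot -scalemxAr mxE. Qed.

Lemma dotZl n a (x y : 'cV[R]_n) : dot (a *: x) y = a * dot x y.
Proof. by rewrite dotC dotZr dotC. Qed.

Lemma dotNr n (x y : 'cV[R]_n) : dot x (- y) = - dot x y.
Proof. by rewrite -scaleN1r dotZr mulN1r. Qed.

Lemma dotNl n (x y : 'cV[R]_n) : dot (- x) y = - dot x y.
Proof. by rewrite dotC dotNr dotC. Qed.

Lemma dotBr n (x y z : 'cV[R]_n) : dot x (y - z) = dot x y - dot x z.
Proof. by rewrite dotDr dotNr. Qed.

Lemma dotBl n (x y z : 'cV[R]_n) : dot (y - z) x = dot y x - dot z x.
Proof. by rewrite dotDl dotNl. Qed.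

Lemma dot0r n (x : 'cV[R]_n) : dot x 0 = 0.
Proof. by rewrite /dot mulmx0 mxE. Qed.

Lemma dot_mulmxl m n (A : 'M[R]_(m, n)) x y : dot (A *m x) y = dot x (A^T *m y).
Proof. by rewrite /dot trmx_mul mulmxA. Qed.

Lemma dot_col_mx m n (x1 y1 : 'cV[R]_m) (x2 y2 : 'cV[R]_n) :
  dot (col_mx x1 x2) (col_mx y1 y2) = dot x1 y1 + dot x2 y2.
Proof. by rewrite /dot tr_col_mx mul_row_col mxE. Qed.

Lemma dotxx_ge0 n (x : 'cV[R]_n) : 0 <= dot x x.
Proof. by rewrite dotE sumr_ge0// => i _; rewrite -expr2 sqr_ge0. Qed.

Lemma dotxx_eq0 n (x : 'cV[R]_n) : (dot x x == 0) = (x == 0).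
Proof.
apply/idP/eqP => [|->]; last by rewrite dot0r.
rewrite dotE psumr_eq0 => [/allP x0|i _]; last by rewrite -expr2 sqr_ge0.
apply/colP => i; have := x0 i; rewrite mem_index_enum mulf_eq0 orbb => /(_ isT).
by rewrite mxE => /eqP.
Qed.

Lemma enormE n (x : 'cV[R]_n) : enorm x = Num.sqrt (dot x x).
Proof. by rewrite /enorm dotE; under eq_bigr do rewrite expr2. Qed.

Lemma enorm_ge0 n (x : 'cV[R]_n) : 0 <= enorm x.
Proof. exact: sqrtr_ge0. Qed.

Lemma enorm_sqr n (x : 'cV[R]_n) : enorm x ^+ 2 = dot x x.
Proof. by rewrite enormE sqr_sqrtr// dotxx_ge0. Qed.

Lemma dot_le n (x y : 'cV[R]_n) : `|dot x y| <= enorm x * enorm y.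
Proof.
rewrite -(@ler_pXn2r _ 2) ?nnegrE ?mulr_ge0 ?enorm_ge0//.
rewrite real_normK ?num_real// exprMn !enorm_sqr.
have [->|y0] := eqVneq y 0; first by rewrite !dot0r mulr0 expr0n.
have b0 : 0 < dot y y by rewrite lt_def dotxx_eq0 y0 dotxx_ge0.
have := dotxx_ge0 (dot y y *: x - dot x y *: y).
rewrite !(dotBl, dotBr, dotZl, dotZr) (dotC y x).
set a := dot x x; set b := dot y y in b0 *; set c := dot x y.
have -> : b * (b * a - c * c) - c * (b * c - c * b) = b * (a * b - c ^+ 2).
  by ring.
by rewrite pmulr_rge0// subr_ge0.
Qed.

Lemma dot_ler n (x y : 'cV[R]_n) : dot x y <= enorm x * enorm y.
Proof. exact: le_trans (ler_norm _) (dot_le x y). Qed.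

(** Duality turns scalar estimates, for which the mean value theorem holds,
    into estimates of vectors. *)
Lemma enorm_dual n (x : 'cV[R]_n) c : 0 <= c ->
  (forall w, dot w x <= c * enorm w) -> enorm x <= c.
Proof.
move=> c0 /(_ x); rewrite -enorm_sqr expr2.
have [->//|x0] := eqVneq (enorm x) 0.
by rewrite ler_pM2r// lt_def x0 enorm_ge0.
Qed.

Lemma enormN n (x : 'cV[R]_n) : enorm (- x) = enorm x.
Proof. by rewrite !enormE dotNr dotNl opprK. Qed.

Lemma enormD n (x y : 'cV[R]_n) : enorm (x + y) <= enorm x + enorm y.
Proof.
rewrite -(@ler_pXn2r _ 2) ?nnegrE ?addr_ge0 ?enorm_ge0//.
rewrite sqrrD !enorm_sqr dotDl !dotDr (dotC y x).
have := dot_ler x y; lra.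
Qed.

End Dot.

Section Rayleigh.
Context {R : realType} {n : nat}.
Implicit Types (P S : 'M[R]_n) (x : 'cV[R]_n).

Lemma posdefmx_dot P x : posdefmx P -> x != 0 -> 0 < dot x (P *m x).
Proof. by move=> [_ P0] /P0; rewrite /dot mulmxA. Qed.

Lemma posdefmx_unit P : posdefmx P -> P \in unitmx.
Proof.
move=> Ppd; rewrite -row_free_unit -kermx_eq0; apply/rowV0P => v /sub_kermxP vP0.
apply/eqP; rewrite -trmx_eq0; apply/negP => /negP v0.
have := posdefmx_dot Ppd v0.
by rewrite dotC dot_mulmxl -Ppd.1 trmxK /dot trmxK mulmxA vP0 mul0mx mxE ltxx.
Qed.

Lemma posdefmx1 : posdefmx (1%:M : 'M[R]_n).
Proof.
split=> [|x x0]; first by rewrite trmx1.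
by rewrite mulmx1 -/(dot x x) lt_def dotxx_eq0 x0 dotxx_ge0.
Qed.

(** A positive semidefinite form vanishes on a vector only if the vector is in
    its kernel: otherwise it would be negative at some [c + t *: w]. *)
Lemma psd_kernel S c : S^T = S -> (forall x, 0 <= dot x (S *m x)) ->
  dot c (S *m c) = 0 -> S *m c = 0.
Proof.
move=> Ssym S0 c0; apply/eqP; rewrite -dotxx_eq0; set w := S *m c.
set k := dot w (S *m w); have k0 : 0 <= k := S0 w.
apply/eqP/le_anti; rewrite dotxx_ge0 andbT leNgt; apply/negP => w0.
have k1 : 0 < k + 1 by rewrite ltr_wpDl.
(* The step [- u] along [w] is small enough for the linear term to win. *)
set D := dot w w in w0; pose u := D / (k + 1).
have u0 : 0 < u by rewrite divr_gt0.
have DE : D = u * (k + 1) by rewrite divfK// gt_eqF.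
have := S0 (c + (- u) *: w).
rewrite mulmxDr dotDl !dotDr -scalemxAr !dotZl !dotZr c0 add0r -/w -/D -/k.
rewrite -[in dot c _]Ssym -dot_mulmxl -/w -/D DE.
have -> : - u * (u * (k + 1)) + (- u * (u * (k + 1)) + - u * (- u * k)) =
  - (u ^+ 2 * (k + 2)) by ring.
by rewrite oppr_ge0 leNgt mulr_gt0// ?exprn_gt0// ltr_wpDl.
Qed.

Lemma quad_continuous S : continuous (fun u : 'rV[R]_n => dot u^T (S *m u^T)).
Proof.
move=> u; have uT : v^T @[v --> u] --> u^T.
  by have := @cvg_trmx R _ (nbhs u) _ 1 n id u; apply; exact: cvg_id.
have H := cvg_mulmx (cvg_trmx uT) (cvg_mulmx (cvg_cst S) uT).
exact: ((cvg_mxP _ _).1 (H _ _ _ _) ord0 ord0).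
Qed.

(** The quotient [x^T S x / x^T P x] is homogeneous of degree [0], so it attains
    its maximum [a], already on the compact unit sphere of the max-norm. The form
    [a P - S] is positive semidefinite and vanishes at a maximizer [c], so that
    [S c = a P c]. *)
Lemma rayleigh P S : (0 < n)%N -> posdefmx P -> S^T = S ->
  exists2 a : R, eigenvalue (invmx P *m S) a &
    forall x, dot x (S *m x) <= a * dot x (P *m x).
Proof.
move=> n0 Ppd Ssym.
pose p (u : 'rV[R]_n) := dot u^T (P *m u^T).
pose q (u : 'rV[R]_n) := dot u^T (S *m u^T).
have p0 u : u != 0 -> 0 < p u by rewrite -trmx_eq0; exact: posdefmx_dot.
pose A := [set u : 'rV[R]_n | `|u| = 1].
have A0 u : A u -> u != 0.
  by move=> uA; apply: contra_eq_neq uA => ->; rewrite normr0 eq_sym oner_neq0.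
have cA : compact A.
  apply: bounded_closed_compact.
    by exists 1; split; [exact: num_real|move=> M M1 u /= ->; exact: ltW].
  rewrite (_ : A = (fun u : 'rV[R]_n => `|u|) @^-1` [set 1])//.
  apply: closed_comp; last exact: closed_eq.
  by move=> u _; exact: norm_continuous.
have An0 : A !=set0.
  pose v : 'rV[R]_n := const_mx 1.
  have v0 : v != 0.
    apply/eqP => /rowP /(_ (Ordinal n0)); rewrite !mxE => /eqP.
    by rewrite oner_eq0.
  exists (`|v|^-1 *: v).
  by rewrite /A/= normrZ normfV normr_id mulVf// normr_eq0.
have [c cA1 cmax] : exists2 c, c \in A & forall u, u \in A -> q u / p u <= q c / p c.
  apply: compact_EVT_max => //; apply: continuous_in_subspaceT => u.
  rewrite inE => /A0 u0.
  apply: (@continuousM R _ q (fun v => (p v)^-1)); first exact: quad_continuous.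
  by apply: (@continuousV R _ p); [rewrite gt_eqF// p0|exact: quad_continuous].
have c0 : c != 0 by apply: A0; rewrite inE in cA1.
set a := q c / p c in cmax.
have qc : q c = a * p c by rewrite divfK// gt_eqF// p0.
have qp x : dot x (S *m x) <= a * dot x (P *m x).
  have [->|x0] := eqVneq x 0; first by rewrite !mulmx0 !dot0r mulr0.
  have xT0 : x^T != 0 by rewrite trmx_eq0.
  have := cmax (`|x^T|^-1 *: x^T); rewrite inE.
  have k0 : `|x^T| != 0 by rewrite normr_eq0.
  rewrite {1}/A/= normrZ normfV normr_id mulVf// => /(_ erefl).
  rewrite /q /p [(_ *: _)^T]linearZ/= trmxK -!scalemxAr !dotZr !dotZl.
  set k := `|x^T|; rewrite !mulrA -mulf_div divff ?mul1r; last first.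
    by rewrite mulf_neq0// invr_neq0.
  by rewrite ler_pdivrMr// posdefmx_dot.
exists a => //.
have Psym := Ppd.1.
have /eqP : (a *: P - S) *m c^T = 0.
  apply: psd_kernel => [|x|].
  - by rewrite linearB/= linearZ/= Ppd.1 Ssym.
  - by rewrite mulmxBl -scalemxAl dotBr dotZr subr_ge0.
  - by rewrite mulmxBl -scalemxAl dotBr dotZr -/(p c) -/(q c) qc subrr.
rewrite mulmxBl subr_eq0 -scalemxAl => /eqP cS.
(* Eigenvectors are row vectors, hence the factor [P]. *)
apply/eigenvalueP; exists (c *m P).
  rewrite mulmxA mulmxK ?posdefmx_unit//.
  by apply: trmx_inj; rewrite trmx_mul linearZ/= trmx_mul Ssym Psym cS.
apply: contra_neq c0 => cP0.
by rewrite -[c](mulmxK (posdefmx_unit Ppd)) cP0 mul0mx.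
Qed.

Lemma eigenvalue_quotient P S b : posdefmx P -> S^T = S ->
  eigenvalue (invmx P *m S) b ->
  exists2 x, x != 0 & dot x (S *m x) = b * dot x (P *m x).
Proof.
move=> Ppd Ssym /eigenvalueP[v vE v0]; have Pu := posdefmx_unit Ppd.
have Psym := Ppd.1; set u := v *m invmx P.
have uP : u *m P = v by rewrite mulmxKV.
exists u^T.
  by rewrite trmx_eq0; apply: contra_neq v0 => u0; rewrite -uP u0 mul0mx.
have -> : S *m u^T = b *: (P *m u^T).
  apply: trmx_inj; rewrite linearZ/= !trmx_mul !trmxK Ssym Psym uP.
  by rewrite -mulmxA vE.
by rewrite dotZr.
Qed.

(** Each eigenvalue of [P^-1 S] is a value of the quotient, so the maximum of
    the quotient is the largest eigenvalue. *)
Lemma lambda_maxP P S : (0 < n)%N -> posdefmx P -> S^T = S ->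
  forall x, dot x (S *m x) <= lambda_max (invmx P *m S) * dot x (P *m x).
Proof.
move=> n0 Ppd Ssym; have [a aE aS] := rayleigh n0 Ppd Ssym.
have aub b : eigenvalue (invmx P *m S) b -> b <= a.
  move=> /(eigenvalue_quotient Ppd Ssym)[x x0 xS].
  by have := aS x; rewrite xS ler_pM2r// posdefmx_dot.
suff -> : lambda_max (invmx P *m S) = a by [].
apply/le_anti/andP; split; first by apply: ge_sup => //; exists a.
by apply: ub_le_sup => //; exists a.
Qed.

(** Here the quotient of [- S] by the identity is maximized. *)
Lemma lambda_minP S : (0 < n)%N -> posdefmx S ->
  0 < lambda_min S /\ forall x, lambda_min S * dot x x <= dot x (S *m x).
Proof.
move=> n0 Spd; have Ssym := Spd.1.
have NSsym : (- S)^T = - S by rewrite linearN/= Ssym.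
have [a aE aS] := rayleigh n0 posdefmx1 NSsym.
have eN b : eigenvalue S b -> exists2 x, x != 0 & dot x (S *m x) = b * dot x x.
  have E1 : invmx 1%:M *m S = S by rewrite invmx1 mul1mx.
  rewrite -{1}E1 => /(eigenvalue_quotient posdefmx1 Ssym)[x x0 xE].
  by exists x => //; rewrite xE mul1mx.
have {}aS x : - a * dot x x <= dot x (S *m x).
  by have := aS x; rewrite mulNmx dotNr mul1mx; lra.
have {}aE : eigenvalue S (- a).
  move: aE; rewrite invmx1 mul1mx => /eigenvalueP[v vE v0].
  by apply/eigenvalueP; exists v => //; rewrite scaleNr -vE mulmxN opprK.
have alb b : eigenvalue S b -> - a <= b.
  move=> /eN[x x0 xS]; have := aS x; rewrite xS ler_pM2r//.
  by rewrite lt_def dotxx_eq0 x0 dotxx_ge0.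
have -> : lambda_min S = - a.
  apply/le_anti/andP; split; last by apply: lb_le_inf => //; exists (- a).
  by apply: ge_inf => //; exists (- a).
split=> //; have [x x0 xS] := eN _ aE.
have := posdefmx_dot Spd x0; rewrite xS pmulr_lgt0//.
by rewrite lt_def dotxx_eq0 x0 dotxx_ge0.
Qed.

End Rayleigh.

Section SpectralNorm.
Context {R : realType}.

Lemma opnorm_ge0 m n (A : 'M[R]_(m, n)) : 0 <= opnorm A.
Proof. exact: sqrtr_ge0. Qed.

Lemma opnormN m n (A : 'M[R]_(m, n)) : opnorm (- A) = opnorm A.
Proof. by rewrite /opnorm [(- A)^T]linearN/= mulNmx mulmxN opprK. Qed.

Lemma enorm_mulmx m n (A : 'M[R]_(m, n)) x : enorm (A *m x) <= opnorm A * enorm x.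
Proof.
case: n A x => [|n] A x.
  by rewrite (flatmx0 x) mulmx0 enormE dot0r sqrtr0 mulr_ge0 ?opnorm_ge0 ?enorm_ge0.
have AAsym : (A^T *m A)^T = A^T *m A by rewrite trmx_mul trmxK.
have := lambda_maxP (ltn0Sn n) posdefmx1 AAsym x.
rewrite invmx1 !mul1mx -mulmxA -dot_mulmxl => H.
rewrite !enormE mulrC -sqrtrM ?dotxx_ge0//; apply: ler_wsqrtr.
by rewrite mulrC.
Qed.

Lemma dot_mulmx_ler m n (A : 'M[R]_(m, n)) x y :
  dot x (A *m y) <= opnorm A * (enorm x * enorm y).
Proof.
apply: le_trans (dot_ler _ _) _; rewrite mulrCA ler_wpM2l ?enorm_ge0//.
exact: enorm_mulmx.
Qed.

Lemma dot_mulmx_lel m n (A : 'M[R]_(m, n)) x y :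
  dot (A *m y) x <= opnorm A * (enorm x * enorm y).
Proof. by rewrite dotC dot_mulmx_ler. Qed.

Lemma enorm_delta n (i : 'I_n) : enorm (delta_mx i ord0 : 'cV[R]_n) = 1.
Proof.
rewrite enormE dotE (bigD1 i)//= big1 => [|j ji].
  by rewrite !mxE !eqxx mulr1 addr0 sqrtr1.
by rewrite !mxE (negPf ji) mul0r.
Qed.

Lemma entry_dot m n (A : 'M[R]_(m, n)) i j :
  A i j = dot (delta_mx i ord0) (A *m delta_mx j ord0).
Proof.
rewrite -colE dotE (bigD1 i)//= big1 => [|k ki]; rewrite !mxE ?eqxx.
  by rewrite mul1r addr0.
by rewrite (negPf ki) mul0r.
Qed.

Lemma enorm_col_mx_sqr m n (x : 'cV[R]_m) (y : 'cV[R]_n) :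
  enorm (col_mx x y) ^+ 2 = enorm x ^+ 2 + enorm y ^+ 2.
Proof. by rewrite !enorm_sqr dot_col_mx. Qed.

Lemma enorm_col_mx_le m n (x : 'cV[R]_m) (y : 'cV[R]_n) :
  enorm (col_mx x y) <= enorm x + enorm y.
Proof.
rewrite -(@ler_pXn2r _ 2) ?nnegrE ?addr_ge0 ?enorm_ge0// enorm_col_mx_sqr.
have := mulr_ge0 (enorm_ge0 x) (enorm_ge0 y); lra.
Qed.

Lemma enorm_usub m n (x : 'cV[R]_(m + n)) : enorm (usubmx x) <= enorm x.
Proof.
rewrite -(@ler_pXn2r _ 2) ?nnegrE ?enorm_ge0// -[in leRHS](vsubmxK x).
by rewrite enorm_col_mx_sqr lerDl sqr_ge0.
Qed.

Lemma enorm_dsub m n (x : 'cV[R]_(m + n)) : enorm (dsubmx x) <= enorm x.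
Proof.
rewrite -(@ler_pXn2r _ 2) ?nnegrE ?enorm_ge0// -[in leRHS](vsubmxK x).
by rewrite enorm_col_mx_sqr lerDr sqr_ge0.
Qed.

End SpectralNorm.

(** * The matrix exponential *)

Section MatrixExponential.
Context {R : realType} {n : nat}.
Implicit Types (A : 'M[R]_n) (s : R).

Let expsum A (k : nat) : 'M[R]_n := \sum_(i < k) (i`!%:R)^-1 *: A ^+ i.

Lemma expr_mx_bound A :
  exists2 C : R, 0 <= C & forall i j k, `|(A ^+ i) j k| <= C ^+ i.
Proof.
pose C := \sum_j \sum_k `|A j k|.
have C0 : 0 <= C by do 2 rewrite sumr_ge0// => ? _.
exists C => //; elim=> [|i IHi] j k.
  by rewrite !expr0 mxE; case: eqP; rewrite ?normr1 ?normr0.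
rewrite !exprS -mulmxE mxE (le_trans (ler_norm_sum _ _ _))//.
apply: (@le_trans _ _ ((\sum_l `|A j l|) * C ^+ i)).
  by rewrite mulr_suml ler_sum// => l _; rewrite normrM ler_wpM2l.
rewrite ler_wpM2r ?exprn_ge0// /C [leRHS](bigD1 j)//= lerDl.
by do 2 rewrite sumr_ge0// => ? _.
Qed.

Lemma expr_scalemx A s i : (s *: A) ^+ i = s ^+ i *: A ^+ i.
Proof.
elim: i => [|i IHi]; first by rewrite !expr0 scale1r.
by rewrite !exprS IHi -!mulmxE -scalemxAl -scalemxAr scalerA.
Qed.

(** Coefficients of the power series of an entry of the [p]th derivative of
    [s |-> expmx (s *: A)]. *)
Let coef A p j k i : R := (i`!%:R)^-1 * (A ^+ (i + p)) j k.

Let coef_cvg A p j k s : cvgn (pseries (coef A p j k) s).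
Proof.
have [C C0 AC] := expr_mx_bound A.
apply: normed_cvg.
apply: (@series_le_cvg _ _ (fun i => C ^+ p * exp_coeff (C * `|s|) i)).
- by move=> i; rewrite normr_ge0.
- by move=> i; rewrite mulr_ge0 ?exprn_ge0// exp_coeff_ge0// mulr_ge0.
- move=> i; rewrite /coef /exp_coeff/= !normrM normfV normr_nat normrX exprMn.
  rewrite [leRHS](_ : _ = i`!%:R^-1 * C ^+ (i + p) * `|s| ^+ i); last first.
    by rewrite exprD; ring.
  by rewrite ler_wpM2r ?exprn_ge0// ler_wpM2l ?invr_ge0.
- exact/is_cvg_seriesZ/is_cvg_series_exp_coeff.
Qed.

Let coef_diffs A p j k : pseries_diffs (coef A p j k) = coef A p.+1 j k.
Proof.
apply/funext => i; rewrite /pseries_diffs /coef factS natrM addSnnS.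
by rewrite invfM !mulrA mulfV ?mul1r// pnatr_eq0.
Qed.

Let coef_is_derive A p j k s :
  is_derive s 1 (fun s => limn (pseries (coef A p j k) s))
    (limn (pseries (coef A p.+1 j k) s)).
Proof.
rewrite -coef_diffs; apply: (@pseries_snd_diffs _ _ (`|s| + 1)).
- exact: coef_cvg.
- by rewrite coef_diffs; exact: coef_cvg.
- by rewrite !coef_diffs; exact: coef_cvg.
- by rewrite [ltRHS]ger0_norm ?addr_ge0// ltrDl.
Qed.

Let expsum_coef A s j k m : expsum (s *: A) m j k = pseries (coef A 0 j k) s m.
Proof.
rewrite /pseries /series/= big_mkord summxE; apply: eq_bigr => i _.
by rewrite expr_scalemx scalerA mxE /coef addn0; ring.
Qed.

Lemma expmx_cvg A : expsum A m @[m --> \oo] --> expmx A.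
Proof.
suff : cvgn (expsum A) by [].
apply/cvg_ex; exists (\matrix_(j, k) limn (pseries (coef A 0 j k) 1)).
apply/cvg_mxP => j k; rewrite mxE.
rewrite (_ : (fun m => expsum A m j k) = pseries (coef A 0 j k) 1).
  exact: coef_cvg.
by apply/funext => m; rewrite -expsum_coef scale1r.
Qed.

Arguments expmx_cvg : clear implicits.

Lemma expmx_unique A M : expsum A m @[m --> \oo] --> M -> M = expmx A.
Proof. by move=> AM; apply/esym; apply: (cvg_lim _ AM); exact: norm_hausdorff. Qed.

Lemma expmx_comm A M : A *m M = M *m A -> expmx A *m M = M *m expmx A.
Proof.
move=> AM; have AiM i : A ^+ i *m M = M *m A ^+ i.
  elim: i => [|i IHi]; first by rewrite !expr0 mul1mx mulmx1.
  by rewrite exprS -mulmxE -mulmxA IHi mulmxA AM -mulmxA.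
have l : expsum A m *m M @[m --> \oo] --> expmx A *m M.
  exact: (cvg_mulmx (expmx_cvg A) (cvg_cst M)).
have r : M *m expsum A m @[m --> \oo] --> M *m expmx A.
  exact: (cvg_mulmx (cvg_cst M) (expmx_cvg A)).
rewrite (_ : (fun m => expsum A m *m M) = fun m => M *m expsum A m) in l.
  by rewrite -(cvg_lim _ l)// (cvg_lim _ r).
apply/funext => m.
rewrite /expsum mulmx_suml mulmx_sumr; apply: eq_bigr => i _.
by rewrite -scalemxAl -scalemxAr AiM.
Qed.

Lemma trmx_expr A i : (A ^+ i)^T = A^T ^+ i.
Proof.
elim: i => [|i IHi]; first by rewrite !expr0 trmx1.
by rewrite exprS exprSr -!mulmxE trmx_mul IHi.
Qed.

Lemma expmx_tr A : expmx A^T = (expmx A)^T.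
Proof.
apply/esym/expmx_unique.
have : (expsum A m)^T @[m --> \oo] --> (expmx A)^T.
  exact: (cvg_trmx (expmx_cvg A)).
rewrite (_ : (fun m => (expsum A m)^T) = expsum A^T)//; apply/funext => m.
by rewrite /expsum linear_sum/=; apply: eq_bigr => i _; rewrite linearZ/= trmx_expr.
Qed.

Lemma expmx0 : expmx (0 : 'M[R]_n) = 1%:M.
Proof.
apply/esym/expmx_unique; rewrite -cvg_shiftS.
rewrite (_ : [sequence _]_m = fun=> 1%:M); first exact: cvg_cst.
apply/funext => m; rewrite /= /expsum big_ord_recl big1 => [|i _].
  by rewrite addr0 expr0 fact0 invr1 scale1r.
by rewrite lift0 expr0n scaler0.
Qed.

(** Entrywise, this is term-by-term differentiation of a power series. *)
Lemma is_derive_expmx A s :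
  is_derive s 1 (fun s => expmx (s *: A)) (expmx (s *: A) *m A).
Proof.
apply/is_derive_mxP => j k.
have entry u j' k' : expmx (u *: A) j' k' = limn (pseries (coef A 0 j' k') u).
  apply/esym/cvg_lim => //; have /cvg_mxP/(_ j' k') := expmx_cvg (u *: A).
  by under eq_fun do rewrite expsum_coef.
under eq_fun do rewrite entry.
apply: (is_derive_eq (coef_is_derive A 0 j k s)); apply/cvg_lim => //.
have : expsum (s *: A) m *m A @[m --> \oo] --> expmx (s *: A) *m A.
  exact: (cvg_mulmx (expmx_cvg (s *: A)) (cvg_cst A)).
move=> /cvg_mxP/(_ j k).
rewrite (_ : (fun m => _) = pseries (coef A 1 j k) s)//; apply/funext => m.
rewrite mxE /pseries /series/= big_mkord.
under eq_bigr do rewrite expsum_coef /pseries /series/= big_mkord mulr_suml.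
rewrite exchange_big/=; apply: eq_bigr => i _.
rewrite /coef addn0 addn1 exprSr -mulmxE mxE mulr_sumr mulr_suml.
by apply: eq_bigr => l _; ring.
Qed.

Lemma is_derive_expmxN A s :
  is_derive s 1 (fun s => expmx (- (s *: A))) (- (expmx (- (s *: A)) *m A)).
Proof.
under eq_fun do rewrite -scalerN; rewrite -scalerN -mulmxN.
exact: is_derive_expmx.
Qed.

Lemma expmx_scale_comm A s : expmx (s *: A) *m A = A *m expmx (s *: A).
Proof. by apply: expmx_comm; rewrite -scalemxAl -scalemxAr. Qed.

(** The product has derivative zero in [s], hence keeps its value at [0]. *)
Lemma expmxN_mul A s : expmx (- (s *: A)) *m expmx (s *: A) = 1%:M.
Proof.
pose G s := expmx (- (s *: A)) *m expmx (s *: A).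
have Gd (t : R) : is_derive t 1 G 0.
  apply: (is_derive_eq (is_derive_mulmx (is_derive_expmxN _ _)
    (is_derive_expmx _ _))).
  by rewrite expmx_scale_comm mulNmx mulmxA addNr.
have G0 : G 0 = 1%:M by rewrite /G scale0r oppr0 expmx0 mulmx1.
rewrite -[LHS]/(G s) -G0; apply/matrixP => i j.
apply: (@is_derive_0_is_cst _ (fun t => G t i j)) => t.
by have /is_derive_mxP/(_ i j) := Gd t; rewrite mxE.
Qed.

Lemma expmx_mulN A s : expmx (s *: A) *m expmx (- (s *: A)) = 1%:M.
Proof. exact: mulmx1C (expmxN_mul A s). Qed.

Lemma expmx_mulNK m A s (v : 'M[R]_(n, m)) :
  expmx (s *: A) *m (expmx (- (s *: A)) *m v) = v.
Proof. by rewrite mulmxA expmx_mulN mul1mx. Qed.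

End MatrixExponential.

(** * Entrywise integrals *)

Section EntrywiseIntegral.
Context {R : realType}.
Notation mu := (@lebesgue_measure R).
Implicit Types (s : seq R) (a b C : R).

(** The discontinuities cut the interval into pieces on whose interiors the
    function is continuous, hence measurable; adding end points is harmless. *)
Lemma measurable_fun_except (f : R -> R) s a b : a <= b ->
  (forall x, a < x < b -> x \notin s -> {for x, continuous f}) ->
  measurable_fun `[a, b] f.
Proof.
elim: s a b => [|c s IHs] a b ab fc.
  apply: (@measurable_realfun.measurable_fun_itv_cc _ _ _ false true).
  apply: measurable_realfun.open_continuous_measurable_fun => [|x]; first exact: itv_open.
  by rewrite inE/= in_itv/= => /fc; exact.
have [|cab] := boolP (a < c < b); last first.
  apply: IHs => // x xab xs; apply: fc => //; rewrite inE negb_or xs andbT.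
  by apply: contraNneq cab => <-.
move=> /andP[ac cb].
have -> : `[a, b]%classic = `[a, c]%classic `|` `[c, b]%classic.
  apply/seteqP; split=> x /=; rewrite !in_itv/=.
    by move=> /andP[-> ->]; rewrite andbT; case: (leP x c) => [|/ltW]; [left|right].
  by move=> [/andP[-> xc]|/andP[cx ->]]; rewrite ?(le_trans xc (ltW cb))//
    (le_trans (ltW ac) cx).
apply/measurable_funU => //; split; apply: IHs (ltW _) _ => // x /andP[x1 x2] xs.
  apply: fc; first by rewrite x1 (lt_trans x2).
  by rewrite inE negb_or xs lt_eqF.
apply: fc; first by rewrite x2 (lt_trans ac).
by rewrite inE negb_or xs gt_eqF.
Qed.

Lemma integrable_except (f : R -> R) s a b C : a <= b ->
  (forall x, a < x < b -> x \notin s -> {for x, continuous f}) ->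
  (forall x, a < x < b -> `|f x| <= C) ->
  mu.-integrable `[a, b] (EFin \o f).
Proof.
move=> ab fc fC; apply: measurable_bounded_integrable => //.
- exact/compact_finite_measure/segment_compact.
- exact: measurable_fun_except ab fc.
(* The bound [C] is not assumed at the end points. *)
exists (Num.max C (Num.max `|f a| `|f b|)); split; first exact: num_real.
move=> M CM x /=; rewrite in_itv/= => /andP[ax xb]; apply/ltW.
apply: le_lt_trans CM; rewrite !le_max.
move: ax; rewrite le_eqVlt => /predU1P[<-|ax]; first by rewrite lexx !orbT.
move: xb; rewrite le_eqVlt => /predU1P[->|xb]; first by rewrite lexx !orbT.
by rewrite fC// ax xb.
Qed.

Section Primitive.
Variables (m n : nat) (F : R -> 'M[R]_(m, n)) (s : seq R) (a b C : R).
Hypothesis ab : a < b.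
Hypothesis Fc : forall x, a < x < b -> x \notin s -> {for x, continuous F}.
Hypothesis FC : forall x i j, a < x < b -> `|F x i j| <= C.

Let Fij_c i j x : {for x, continuous F} -> {for x, continuous (fun t => F t i j)}.
Proof. by move=> /cvg_mxP; apply. Qed.

Let F_integrable i j : mu.-integrable `[a, b] (EFin \o (fun t => F t i j)).
Proof.
apply: (@integrable_except _ s _ _ C) (ltW ab) _ _ => x xab; last exact: FC.
by move=> xs; apply/Fij_c/Fc.
Qed.

Lemma intmx_continuous i j :
  {within `[a, b], continuous (fun t => intmx a t F i j)}.
Proof.
rewrite (_ : (fun t => _) =
    fun t => parameterized_integral mu a t (fun u => F u i j)).
  exact: (parameterized_integral_continuous (ltW ab) (F_integrable i j)).
by apply/funext => t; rewrite mxE.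
Qed.

(** The fundamental theorem of calculus at a point of continuity. *)
Lemma is_derive_intmx x : a < x < b -> {for x, continuous F} ->
  is_derive x 1 (fun t => intmx a t F) (F x).
Proof.
move=> /andP[ax xb] cF; apply/is_derive_mxP => i j.
have [d dE] := continuous_FTC1_closed xb (F_integrable i j) ax (Fij_c cF).
under eq_fun do rewrite mxE.
by apply: DeriveDef; [exact: d|rewrite -derive1E; exact: dE].
Qed.

Lemma intmx_aa : intmx a a F = 0.
Proof. by apply/matrixP => i j; rewrite !mxE set_itv1 Rintegral_set1. Qed.

End Primitive.

End EntrywiseIntegral.

(** * Scalar estimates *)

Section ScalarEstimates.
Context {R : realType}.
Implicit Types (k q x y s mu : R).

(** The right-hand factor is the largest eigenvalue of the symmetric matrix
    with rows [(0, k)] and [(k, q)]. *)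
Lemma quad_form_le k q x y :
  2 * k * x * y + q * y ^+ 2 <=
  2^-1 * (q + Num.sqrt (q ^+ 2 + 4 * k ^+ 2)) * (x ^+ 2 + y ^+ 2).
Proof.
set r := Num.sqrt _; set l := 2^-1 * (q + r).
have d0 : 0 <= q ^+ 2 + 4 * k ^+ 2 by have := sqr_ge0 q; have := sqr_ge0 k; lra.
have r2 : r ^+ 2 = q ^+ 2 + 4 * k ^+ 2 by rewrite sqr_sqrtr.
have qr : `|q| <= r.
  rewrite -sqrtr_sqr; apply: ler_wsqrtr.
  by have := sqr_ge0 k; lra.
have [qr1 qr2] : - q <= r /\ q <= r by move: qr; rewrite ler_norml; lra.
have l0 : 0 <= l by rewrite /l; lra.
have lq : 0 <= l - q by rewrite /l; lra.
have llq : l * (l - q) = k ^+ 2.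
  have -> : l * (l - q) = (r ^+ 2 - q ^+ 2) / 4 by rewrite /l; field.
  by rewrite r2; field.
rewrite -subr_ge0.
have -> : l * (x ^+ 2 + y ^+ 2) - (2 * k * x * y + q * y ^+ 2) =
  l * x ^+ 2 - 2 * k * x * y + (l - q) * y ^+ 2 by ring.
have [lE|lN] := eqVneq l 0.
  have k0 : k = 0 by apply/eqP; rewrite -sqrf_eq0 -llq lE mul0r.
  rewrite k0 mulr0 !mul0r subr0.
  by apply: addr_ge0; apply: mulr_ge0; rewrite ?sqr_ge0.
have lp : 0 < l by rewrite lt_def lN l0.
rewrite -(pmulr_rge0 _ lp).
have -> : l * (l * x ^+ 2 - 2 * k * x * y + (l - q) * y ^+ 2) =
  (l * x - k * y) ^+ 2 + (l * (l - q) - k ^+ 2) * y ^+ 2 by ring.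
by rewrite llq subrr mul0r addr0 sqr_ge0.
Qed.

Lemma is_derive_expRM k s :
  is_derive s 1 (fun s => expR (k * s)) (k * expR (k * s)).
Proof.
have kd : is_derive s 1 (fun s => k * s) k.
  by apply: is_derive_eq; rewrite /GRing.scale/= mulr1.
have := @is_derive1_comp _ (@expR R) (fun s => k * s) s _ _ (is_derive_expR _) kd.
by rewrite mulrC.
Qed.

(** The primitive of [expR (k * s)] that vanishes at [0]. *)
Definition expprim k s : R := (expR (k * s) - 1) / k.

Lemma is_derive_expprim k s : k != 0 ->
  is_derive s 1 (expprim k) (expR (k * s)).
Proof.
move=> k0; have ed := is_derive_expRM k s.
rewrite /expprim.
apply: (is_derive_eq (is_deriveM (is_deriveB ed (is_derive_cst (1 : R) s 1))
  (is_derive_cst (k^-1 : R) s 1))).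
by rewrite /GRing.scale/= subr0 mulr0 add0r mulrA mulVf// mul1r.
Qed.

Lemma expprim0 k : expprim k 0 = 0.
Proof. by rewrite /expprim mulr0 expR0 subrr mul0r. Qed.

Lemma expprim_ge0 k s : 0 <= s -> 0 <= expprim k s.
Proof.
move=> s0; rewrite /expprim; have [k0|k0|->] := ltgtP k 0; last first.
- by rewrite invr0 mulr0.
- by rewrite divr_ge0 ?(ltW k0)// subr_ge0 -expR0 ler_expR mulr_ge0// ltW.
- apply: mulr_le0; last by rewrite invr_le0 ltW.
  by rewrite subr_le0 -expR0 ler_expR mulr_le0_ge0// ltW.
Qed.

End ScalarEstimates.

Section DotDerivative.
Context {R : realType}.

Lemma is_derive_dot n (f g : R -> 'cV[R]_n) (t : R) df dg :
  is_derive t 1 f df -> is_derive t 1 g dg ->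
  is_derive t 1 (fun s => dot (f s) (g s)) (dot df (g t) + dot (f t) dg).
Proof.
move=> fd gd; have /is_derive_mxP/(_ ord0 ord0) :=
  is_derive_mulmx (is_derive_trmx fd) gd.
by rewrite mxE.
Qed.

Lemma within_dot n A (f g : R -> 'cV[R]_n) :
  {within A, continuous f} -> {within A, continuous g} ->
  {within A, continuous (fun t => dot (f t) (g t))}.
Proof. by move=> fc gc; have /within_mxP := within_mulmx (within_trmx fc) gc; apply. Qed.

Lemma is_derive_mulmxr m n p (f : R -> 'M[R]_(m, n)) (t : R) df (B : 'M[R]_(n, p)) :
  is_derive t 1 f df -> is_derive t 1 (fun s => f s *m B) (df *m B).
Proof.
move=> fd; apply: (is_derive_eq (is_derive_mulmx fd (is_derive_cst B t 1))).
by rewrite mulmx0 addr0.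
Qed.

(** Integrate the derivative [A *m expmx (s *: A)] against a test vector. *)
Lemma expmx_sub1_le n (A : 'M[R]_n) (M mu s : R) (v : 'cV[R]_n) : mu != 0 -> 0 <= s ->
  (forall r : R, 0 <= r -> opnorm (expmx (r *: A)) <= M * expR (r * mu)) ->
  enorm (expmx (s *: A) *m v - v) <= opnorm A * M * expprim mu s * enorm v.
Proof.
move=> mu0 s0 AM.
have M0 : 0 <= M.
  have := AM _ (lexx 0); rewrite mul0r expR0 mulr1; exact: le_trans (opnorm_ge0 _).
apply: enorm_dual.
  rewrite mulr_ge0 ?enorm_ge0// mulr_ge0 ?expprim_ge0//.
  by rewrite mulr_ge0 ?opnorm_ge0.
move=> w; pose f r := dot w (expmx (r *: A) *m v).
pose c := opnorm A * M * enorm v * enorm w.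
have c0 : 0 <= c by rewrite !mulr_ge0 ?opnorm_ge0 ?enorm_ge0.
have fd (r : R) : is_derive r 1 f (dot w (expmx (r *: A) *m A *m v)).
  apply: (is_derive_eq (is_derive_dot (is_derive_cst w r 1)
    (is_derive_mulmxr v (is_derive_expmx A r)))).
  by rewrite dotC dot0r add0r.
have gd (r : R) : is_derive r 1 (fun r => c * expprim mu r) (c * expR (mu * r)).
  apply: (is_derive_eq (is_deriveM (is_derive_cst c r 1)
    (is_derive_expprim r mu0))).
  by rewrite /GRing.scale/= mulr0 addr0.
have := @ler_except _ f (fun r => c * expprim mu r) [::] 0 s s0.
rewrite expprim0 mulr0 subr0 /f scale0r expmx0 mul1mx -dotBr.
rewrite (_ : c * _ = opnorm A * M * expprim mu s * enorm v * enorm w); last first.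
  by rewrite /c; ring.
apply.
- apply: continuous_subspaceT => r.
  exact/differentiable_continuous/derivable1_diffP.
- apply: continuous_subspaceT => r.
  by have rd := gd r; exact/differentiable_continuous/derivable1_diffP.
- move=> r /andP[r0 _] _; do 2 eexists; split; [exact: fd|exact: gd|].
  rewrite expmx_scale_comm -mulmxA (le_trans (dot_mulmx_ler _ _ _))//.
  rewrite (_ : c * _ = opnorm A * (enorm w * (M * expR (r * mu) * enorm v))).
    rewrite ler_wpM2l ?opnorm_ge0// ler_wpM2l ?enorm_ge0//.
    rewrite (le_trans (enorm_mulmx _ _))// ler_wpM2r ?enorm_ge0// AM// ltW//.
  by rewrite /c (mulrC r); ring.
Qed.

End DotDerivative.

(** * The growth exponent as an integral *)

Section ThetaDerivative.
Context {R : realType}.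
Implicit Types (c mu de k s : R).

Let is_derive_exp2 c mu de s : mu != 0 -> de != 0 -> mu + de != 0 ->
  is_derive s 1 (fun s => c / mu *
      ((expR ((mu + de) * s) - 1) / (mu + de) - (expR (de * s) - 1) / de))
    (c * expR (s * de) * expprim mu s).
Proof.
move=> mu0 de0 md0.
apply: (is_derive_eq (is_deriveM (is_derive_cst (c / mu : R) s 1)
  (is_deriveB (is_derive_expprim s md0) (is_derive_expprim s de0)))).
rewrite /GRing.scale/= mulr0 addr0 /expprim mulrDl expRD (mulrC s de); ring.
Qed.

Let is_derive_exp1 c de s : de != 0 ->
  is_derive s 1 (fun s => c / de * ((expR (s * de) - 1) / de - s))
    (c * expprim de s).
Proof.
move=> de0.
rewrite (_ : (fun s => _) = fun s => c / de * (expprim de s - s)); last first.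
  by apply/funext => r; rewrite /expprim (mulrC de).
apply: (is_derive_eq (is_deriveM (is_derive_cst (c / de : R) s 1)
  (is_deriveB (is_derive_expprim s de0) (is_derive_id s 1)))).
rewrite /GRing.scale/= mulr0 addr0 /expprim; ring.
Qed.

Let is_derive_sexp k s : k != 0 ->
  is_derive s 1 (fun s => s * expR (k * s) / k - (expR (k * s) - 1) / k ^+ 2)
    (s * expR (k * s)).
Proof.
move=> k0.
rewrite (_ : (fun s => _) = fun s => (s * expR (k * s) - expprim k s) * k^-1).
  apply: (is_derive_eq (is_deriveM (is_deriveB (is_deriveM (is_derive_id s 1)
    (is_derive_expRM k s)) (is_derive_expprim s k0))
    (is_derive_cst (k^-1 : R) s 1))).
  by rewrite /GRing.scale/= mulr0 add0r; field.
by apply/funext => r; rewrite /expprim; field.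
Qed.

Context {n1 n2 : nat}.
Variables (A11 : 'M[R]_n1) (A22 : 'M[R]_n2).
Variables (mu1 mu2 delta1 delta2 M1 M2 N1 N2 g12 g21 : R).
Variable (P : 'M[R]_(n1 + n2)).
Hypotheses (mu1_neq0 : mu1 != 0) (mu2_neq0 : mu2 != 0)
  (delta1_neq0 : delta1 != 0) (delta2_neq0 : delta2 != 0)
  (mu2_delta1_neq0 : mu2 + delta1 != 0) (mu1_delta2_neq0 : mu1 + delta2 != 0).

Let p11 := opnorm (ulsubmx P).
Let p12 := opnorm (ursubmx P).
Let p22 := opnorm (drsubmx P).
Let q := p11 * g12 + p22 * g21.

(** Bounds on the norms of a conjugated off-diagonal block
    [expmx (- (s *: A)) *m D *m expmx (s *: A')] with [opnorm D <= g], and of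
    its difference with [D]. *)
Definition conj_bound N de g M mu s : R := N * expR (s * de) * (g * (M * expR (s * mu))).

Definition conj_defect p N de g p' M mu s : R :=
  N * expR (s * de) * (g * (p' * M * expprim mu s)) + p * N * expprim de s * g.

(** The bound on [v' / |y|^2] at elapsed time [s]: the two defects are weighted by
    [eta11] and [eta22] of [Theta], and the factor [s] of the last term is the length over
    which the integral [J] has accumulated. *)
Definition theta_rate s : R :=
  (Num.sqrt (p11 ^+ 2 + p12 ^+ 2) + p12) *
    conj_defect (opnorm A11) N1 delta1 g12 (opnorm A22) M2 mu2 s +
  (Num.sqrt (p22 ^+ 2 + p12 ^+ 2) + p12) *
    conj_defect (opnorm A22) N2 delta2 g21 (opnorm A11) M1 mu1 s +
  2 * s * (conj_bound N1 delta1 g12 M2 mu2 s *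
      (2^-1 * (q + Num.sqrt (q ^+ 2 + 16 * g21 ^+ 2 * p12 ^+ 2))) +
    conj_bound N2 delta2 g21 M1 mu1 s *
      (2^-1 * (q + Num.sqrt (q ^+ 2 + 16 * g12 ^+ 2 * p12 ^+ 2)))).

Lemma is_derive_Theta s :
  is_derive s 1
    (fun s => Theta A11 A22 mu1 mu2 delta1 delta2 M1 M2 N1 N2 s g12 g21 P)
    (theta_rate s).
Proof.
rewrite /Theta -/p11 -/p12 -/p22 -/q /theta_rate.
set e11 := Num.sqrt (p11 ^+ 2 + _) + p12.
set e22 := Num.sqrt (p22 ^+ 2 + _) + p12.
set e12 := 2^-1 * (q + Num.sqrt (_ + 16 * g21 ^+ 2 * _)).
set e21 := 2^-1 * (q + Num.sqrt (_ + 16 * g12 ^+ 2 * _)).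
have d1 := is_derive_exp2 (g12 * opnorm A22 * N1 * M2 * e11) s
  mu2_neq0 delta1_neq0 mu2_delta1_neq0.
have d2 := is_derive_exp1 (g12 * opnorm A11 * N1 * e11) s delta1_neq0.
have d3 := is_derive_exp2 (g21 * opnorm A11 * N2 * M1 * e22) s
  mu1_neq0 delta2_neq0 mu1_delta2_neq0.
have d4 := is_derive_exp1 (g21 * opnorm A22 * N2 * e22) s delta2_neq0.
have d5 := is_deriveM (is_derive_cst (g12 * e12 * N1 * M2 : R) s 1)
  (is_derive_sexp s mu2_delta1_neq0).
have d6 := is_deriveM (is_derive_cst (g21 * e21 * N2 * M1 : R) s 1)
  (is_derive_sexp s mu1_delta2_neq0).
have d7 := is_deriveM (is_derive_cst (2 : R) s 1) (is_deriveD d5 d6).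
apply: (is_derive_eq (is_deriveD (is_deriveD (is_deriveD (is_deriveD
  d1 d2) d3) d4) d7)).
rewrite /conj_defect /conj_bound /GRing.scale/= !mulr0 !addr0.
rewrite !(mulrC s) (mulrDl mu2) (mulrDl mu1) !expRD; ring.
Qed.

Lemma Theta0 :
  Theta A11 A22 mu1 mu2 delta1 delta2 M1 M2 N1 N2 0 g12 g21 P = 0.
Proof.
rewrite /Theta -/p11 -/p12 -/p22 -/q.
set e11 := Num.sqrt (p11 ^+ 2 + _) + p12.
set e22 := Num.sqrt (p22 ^+ 2 + _) + p12.
set e12 := 2^-1 * (q + Num.sqrt (_ + 16 * g21 ^+ 2 * _)).
set e21 := 2^-1 * (q + Num.sqrt (_ + 16 * g12 ^+ 2 * _)).
by rewrite !(mulr0, mul0r) expR0 subrr !(mul0r, subr0, mulr0, addr0).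
Qed.

End ThetaDerivative.

(** * The Lyapunov function on one subinterval *)

Section BlockEstimates.
Context {R : realType} {n1 n2 : nat}.
Variables (P : 'M[R]_(n1 + n2)) (P_sym : P^T = P).

Let p11 := opnorm (ulsubmx P).
Let p12 := opnorm (ursubmx P).
Let p22 := opnorm (drsubmx P).

Lemma dot_sym_block_le (u1 w1 : 'cV[R]_n1) (u2 w2 : 'cV[R]_n2) :
  dot (P *m col_mx u1 u2) (col_mx w1 w2) <=
  (p11 * enorm u1 + p12 * enorm u2) * enorm w1 +
  (p12 * enorm u1 + p22 * enorm u2) * enorm w2.
Proof.
have dlE : dlsubmx P = (ursubmx P)^T by rewrite trmx_ursub P_sym.
rewrite -{1}[P]submxK mul_block_col dot_col_mx dlE !dotDl.
rewrite [dot ((ursubmx P)^T *m _) _]dot_mulmxl trmxK.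
have := dot_mulmx_lel (ulsubmx P) w1 u1.
have := dot_mulmx_lel (ursubmx P) w1 u2.
have := dot_mulmx_ler (ursubmx P) u1 w2.
have := dot_mulmx_lel (drsubmx P) w2 u2.
rewrite -/p11 -/p12 -/p22; lra.
Qed.

Definition offdiag_mx (X : 'M[R]_(n1, n2)) (Y : 'M[R]_(n2, n1)) : 'M[R]_(n1 + n2) :=
  block_mx 0 X Y 0.

Lemma offdiag_mx_col X Y (u1 : 'cV[R]_n1) (u2 : 'cV[R]_n2) :
  offdiag_mx X Y *m col_mx u1 u2 = col_mx (X *m u2) (Y *m u1).
Proof. by rewrite mul_block_col !mul0mx add0r addr0. Qed.

(** The derivative of [x^T P x] along [x' = D x] is [x^T (sym_part D) x]. *)
Definition sym_part (D : 'M[R]_(n1 + n2)) : 'M[R]_(n1 + n2) := P *m D + D^T *m P.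

Lemma sym_part_tr D : (sym_part D)^T = sym_part D.
Proof. by rewrite /sym_part linearD/= !trmx_mul trmxK P_sym addrC. Qed.

Lemma dot_sym_part D (x y : 'cV[R]_(n1 + n2)) :
  dot x (sym_part D *m y) = dot (P *m x) (D *m y) + dot (P *m y) (D *m x).
Proof.
rewrite mulmxDl dotDr -!mulmxA -(dot_mulmxl D) [in dot (D *m x) _]dotC.
by rewrite -[in X in X + _]P_sym -dot_mulmxl.
Qed.

Variables g12 g21 : R.
Hypotheses (g12_ge0 : 0 <= g12) (g21_ge0 : 0 <= g21).

(** Bound on [x^T (sym_part D) y] in terms of the norms of the blocks of [x] and
    [y], for an off-diagonal [D] with blocks bounded by [g12] and [g21]. *)
Definition sym_part_bound (x1 x2 y1 y2 : R) : R :=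
  2 * g21 * p12 * x1 * y1 + (p11 * g12 + p22 * g21) * (x1 * y2 + x2 * y1) +
  2 * g12 * p12 * x2 * y2.

Lemma dot_sym_part_le X Y (x1 y1 : 'cV[R]_n1) (x2 y2 : 'cV[R]_n2) :
  opnorm X <= g12 -> opnorm Y <= g21 ->
  dot (col_mx x1 x2) (sym_part (offdiag_mx X Y) *m col_mx y1 y2) <=
  sym_part_bound (enorm x1) (enorm x2) (enorm y1) (enorm y2).
Proof.
move=> Xg Yg; rewrite dot_sym_part !offdiag_mx_col.
apply: le_trans (lerD (dot_sym_block_le _ _ _ _) (dot_sym_block_le _ _ _ _)) _.
have Xle (u : 'cV[R]_n2) : enorm (X *m u) <= g12 * enorm u.
  by rewrite (le_trans (enorm_mulmx _ _))// ler_wpM2r ?enorm_ge0.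
have Yle (u : 'cV[R]_n1) : enorm (Y *m u) <= g21 * enorm u.
  by rewrite (le_trans (enorm_mulmx _ _))// ler_wpM2r ?enorm_ge0.
have le2 (u1 : 'cV[R]_n1) (u2 : 'cV[R]_n2) (p p' : R) c d : 0 <= p -> 0 <= p' -> c <= d ->
    (p * enorm u1 + p' * enorm u2) * c <= (p * enorm u1 + p' * enorm u2) * d.
  by move=> ? ? ?; rewrite ler_wpM2l// addr_ge0 ?mulr_ge0 ?enorm_ge0.
apply: le_trans (lerD (lerD (le2 _ _ _ _ _ _ _ _ (Xle _)) (le2 _ _ _ _ _ _ _ _ (Yle _)))
  (lerD (le2 _ _ _ _ _ _ _ _ (Xle _)) (le2 _ _ _ _ _ _ _ _ (Yle _)))) _;
  rewrite ?opnorm_ge0// /sym_part_bound.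
by rewrite le_eqVlt; apply/orP; left; apply/eqP; ring.
Qed.

Lemma dot_Pimx h (x1 : 'cV[R]_n1) (x2 : 'cV[R]_n2) :
  dot (col_mx x1 x2) (Pimx h g12 g21 P *m col_mx x1 x2) =
  dot (col_mx x1 x2) (P *m col_mx x1 x2) -
  h * ((2 * g21 * p12 + g12 * p11 + g21 * p22) * enorm x1 ^+ 2 +
       (2 * g12 * p12 + g12 * p11 + g21 * p22) * enorm x2 ^+ 2).
Proof.
rewrite -[X in dot _ (X *m _) - _](submxK P) !mul_block_col !dot_col_mx.
rewrite !mulmxBl !mul_scalar_mx !dotDr !dotNr !dotZr !enorm_sqr.
by rewrite -/p11 -/p12 -/p22; ring.
Qed.

(** [2 x y <= x^2 + y^2] splits the mixed term of the integral between the two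
    diagonal blocks. *)
Lemma dot_Pimx_le h t (J : 'M[R]_(n1 + n2)) (x1 : 'cV[R]_n1) (x2 : 'cV[R]_n2) :
  0 <= t <= h ->
  dot (col_mx x1 x2) (J *m col_mx x1 x2) <=
    t * sym_part_bound (enorm x1) (enorm x2) (enorm x1) (enorm x2) ->
  dot (col_mx x1 x2) (Pimx h g12 g21 P *m col_mx x1 x2) <=
  dot (col_mx x1 x2) ((P - J) *m col_mx x1 x2).
Proof.
move=> /andP[t0 th] JB; rewrite dot_Pimx mulmxBl dotBr lerD2l lerN2.
apply: le_trans JB _; rewrite /sym_part_bound.
have x10 := enorm_ge0 x1; have x20 := enorm_ge0 x2.
have k12 : 0 <= g12 * p12 by rewrite mulr_ge0 ?opnorm_ge0.
have k21 : 0 <= g21 * p12 by rewrite mulr_ge0 ?opnorm_ge0.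
have k11 : 0 <= g12 * p11 by rewrite mulr_ge0 ?opnorm_ge0.
have k22 : 0 <= g21 * p22 by rewrite mulr_ge0 ?opnorm_ge0.
have xx := sqr_ge0 (enorm x1 - enorm x2).
set X1 := enorm x1 in x10 xx *; set X2 := enorm x2 in x20 xx *.
have B0 : 0 <= (2 * g21 * p12 + g12 * p11 + g21 * p22) * X1 ^+ 2 +
       (2 * g12 * p12 + g12 * p11 + g21 * p22) * X2 ^+ 2.
  by rewrite addr_ge0// mulr_ge0 ?sqr_ge0//; lra.
apply: le_trans (ler_wpM2r B0 th); rewrite ler_wpM2l//.
have : 0 <= (g12 * p11 + g21 * p22) * (X1 - X2) ^+ 2.
  by rewrite mulr_ge0// addr_ge0.
lra.
Qed.

(** The weight of [d12] is the largest eigenvalue of the quadratic form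
    [2 p11 x1 x2 + 2 p12 x2^2], that of [d21] is obtained by exchanging the
    blocks. *)
Lemma dot_defect_le (d12 d21 : R) (x1 w1 : 'cV[R]_n1) (x2 w2 : 'cV[R]_n2) :
  0 <= d12 -> 0 <= d21 ->
  enorm w1 <= d12 * enorm x2 -> enorm w2 <= d21 * enorm x1 ->
  2 * dot (P *m col_mx x1 x2) (col_mx w1 w2) <=
  ((Num.sqrt (p11 ^+ 2 + p12 ^+ 2) + p12) * d12 +
   (Num.sqrt (p22 ^+ 2 + p12 ^+ 2) + p12) * d21) *
  (enorm x1 ^+ 2 + enorm x2 ^+ 2).
Proof.
move=> d120 d210 w1le w2le; have := dot_sym_block_le x1 w1 x2 w2.
have x10 := enorm_ge0 x1; have x20 := enorm_ge0 x2.
set X1 := enorm x1 in x10 w2le *; set X2 := enorm x2 in x20 w1le *.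
have q1 : (p11 * X1 + p12 * X2) * enorm w1 <= (p11 * X1 + p12 * X2) * (d12 * X2).
  by rewrite ler_wpM2l// addr_ge0 ?mulr_ge0 ?opnorm_ge0.
have q2 : (p12 * X1 + p22 * X2) * enorm w2 <= (p12 * X1 + p22 * X2) * (d21 * X1).
  by rewrite ler_wpM2l// addr_ge0 ?mulr_ge0 ?opnorm_ge0.
have sqrtE p : 2^-1 * (2 * p12 + Num.sqrt ((2 * p12) ^+ 2 + 4 * p ^+ 2)) =
    Num.sqrt (p ^+ 2 + p12 ^+ 2) + p12.
  have -> : (2 * p12) ^+ 2 + 4 * p ^+ 2 = 2 ^+ 2 * (p ^+ 2 + p12 ^+ 2) by ring.
  by rewrite sqrtrM ?sqr_ge0// sqrtr_sqr ger0_norm//; field.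
have := ler_wpM2l d120 (quad_form_le p11 (2 * p12) X1 X2).
have := ler_wpM2l d210 (quad_form_le p22 (2 * p12) X2 X1).
rewrite !sqrtE; lra.
Qed.

(** The largest eigenvalues have [4] in place of [16]; the larger constant is the
    one that occurs in [Theta]. *)
Lemma sym_part_bound_le (c12 c21 x1 x2 w1 w2 : R) :
  0 <= c12 -> 0 <= c21 -> 0 <= x1 -> 0 <= x2 -> w1 <= c12 * x2 -> w2 <= c21 * x1 ->
  let q := p11 * g12 + p22 * g21 in
  sym_part_bound x1 x2 w1 w2 <=
  (c12 * (2^-1 * (q + Num.sqrt (q ^+ 2 + 16 * g21 ^+ 2 * p12 ^+ 2))) +
   c21 * (2^-1 * (q + Num.sqrt (q ^+ 2 + 16 * g12 ^+ 2 * p12 ^+ 2)))) *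
  (x1 ^+ 2 + x2 ^+ 2).
Proof.
move=> c120 c210 x10 x20 w1le w2le; cbv zeta.
set q := p11 * g12 + p22 * g21.
have q0 : 0 <= q by rewrite addr_ge0 ?mulr_ge0 ?opnorm_ge0.
have p120 : 0 <= p12 by exact: opnorm_ge0.
have q1 : (2 * g21 * p12 * x1 + q * x2) * w1 <=
    (2 * g21 * p12 * x1 + q * x2) * (c12 * x2).
  by rewrite ler_wpM2l// addr_ge0// !mulr_ge0.
have q2 : (2 * g12 * p12 * x2 + q * x1) * w2 <=
    (2 * g12 * p12 * x2 + q * x1) * (c21 * x1).
  by rewrite ler_wpM2l// addr_ge0// !mulr_ge0.
have sq4 g : 2^-1 * (q + Num.sqrt (q ^+ 2 + 4 * (g * p12) ^+ 2)) <=
    2^-1 * (q + Num.sqrt (q ^+ 2 + 16 * g ^+ 2 * p12 ^+ 2)).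
  rewrite ler_wpM2l ?invr_ge0// lerD2l; apply: ler_wsqrtr; rewrite lerD2l exprMn.
  have : 0 <= g ^+ 2 * p12 ^+ 2 by rewrite mulr_ge0 ?sqr_ge0.
  lra.
have xy : 0 <= x1 ^+ 2 + x2 ^+ 2 by rewrite addr_ge0 ?sqr_ge0.
have yx : 0 <= x2 ^+ 2 + x1 ^+ 2 by rewrite addrC.
have := ler_wpM2l c120 (le_trans (quad_form_le (g21 * p12) q x1 x2)
  (ler_wpM2r xy (sq4 g21))).
have := ler_wpM2l c210 (le_trans (quad_form_le (g12 * p12) q x2 x1)
  (ler_wpM2r yx (sq4 g12))).
rewrite /sym_part_bound -/q; lra.
Qed.

End BlockEstimates.

Section LyapunovPiece.
Context {R : realType} {n1 n2 : nat}.
Hypotheses (n1_gt0 : (0 < n1)%N).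
Variables (A11 : 'M[R]_n1) (A12 : R -> 'M[R]_(n1, n2))
          (A21 : R -> 'M[R]_(n2, n1)) (A22 : 'M[R]_n2).
Variables (mu1 mu2 delta1 delta2 M1 M2 N1 N2 : R).
Hypotheses (expA11 : forall r : R, 0 <= r ->
    opnorm (expmx (r *: A11)) <= M1 * expR (r * mu1))
  (expA22 : forall r : R, 0 <= r ->
    opnorm (expmx (r *: A22)) <= M2 * expR (r * mu2))
  (expNA11 : forall r : R, 0 <= r ->
    opnorm (expmx (- (r *: A11))) <= N1 * expR (r * delta1))
  (expNA22 : forall r : R, 0 <= r ->
    opnorm (expmx (- (r *: A22))) <= N2 * expR (r * delta2)).
Hypotheses (mu1_neq0 : mu1 != 0) (mu2_neq0 : mu2 != 0)
  (delta1_neq0 : delta1 != 0) (delta2_neq0 : delta2 != 0)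
  (mu2_delta1_neq0 : mu2 + delta1 != 0) (mu1_delta2_neq0 : mu1 + delta2 != 0).
Variables (g12 g21 : R) (P : 'M[R]_(n1 + n2)) (a b : R) (s : seq R).
Hypotheses (g12_ge0 : 0 <= g12) (g21_ge0 : 0 <= g21) (P_sym : P^T = P).
Hypothesis ab : a < b.
Hypotheses (A12c : forall t, a < t < b -> t \notin s -> {for t, continuous A12})
  (A21c : forall t, a < t < b -> t \notin s -> {for t, continuous A21}).
Hypotheses (A12g : forall t, a < t < b -> opnorm (A12 t) <= g12)
  (A21g : forall t, a < t < b -> opnorm (A21 t) <= g21).

Let D t := offdiag_mx (A12 t) (A21 t).
Let S t := sym_part P (D t).
Let J t := intmx a t S.

Let S_bounded t i j : a < t < b -> `|S t i j| <= 2 * opnorm P * (g12 + g21).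
Proof.
move=> tab; have Dle (x : 'cV[R]_(n1 + n2)) : enorm (D t *m x) <= (g12 + g21) * enorm x.
  rewrite -[in leLHS](vsubmxK x) /D offdiag_mx_col mulrDl (le_trans (enorm_col_mx_le _ _))//.
  apply: lerD; apply: le_trans (enorm_mulmx _ _) _.
    by apply: ler_pM; rewrite ?opnorm_ge0 ?enorm_ge0 ?A12g ?enorm_dsub.
  by apply: ler_pM; rewrite ?opnorm_ge0 ?enorm_ge0 ?A21g ?enorm_usub.
have PD (x y : 'cV[R]_(n1 + n2)) : enorm x = 1 -> enorm y = 1 ->
    `|dot (P *m x) (D t *m y)| <= opnorm P * (g12 + g21).
  move=> x1 y1; apply: le_trans (dot_le _ _) _.
  apply: ler_pM; rewrite ?enorm_ge0//.
    by rewrite (le_trans (enorm_mulmx _ _))// x1 mulr1.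
  by rewrite (le_trans (Dle _))// y1 mulr1.
rewrite entry_dot dot_sym_part; last exact: P_sym.
apply: le_trans (ler_normD _ _) _.
by rewrite -mulrA mulr_natl mulr2n; apply: lerD; apply: PD; exact: enorm_delta.
Qed.

Let D_continuous t : {for t, continuous A12} -> {for t, continuous A21} ->
  {for t, continuous D}.
Proof.
move=> c12 c21; apply/cvg_mxP => i j.
case: (split_ordP i) => i' ->; case: (split_ordP j) => j' ->;
  rewrite /D /offdiag_mx ?(block_mxEul, block_mxEur, block_mxEdl, block_mxEdr, mxE);
  under eq_fun do
    rewrite ?(block_mxEul, block_mxEur, block_mxEdl, block_mxEdr, mxE).
- exact: cvg_cst.
- by have /cvg_mxP := c12; apply.
- by have /cvg_mxP := c21; apply.
- exact: cvg_cst.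
Qed.

Let S_continuous t : a < t < b -> t \notin s -> {for t, continuous S}.
Proof.
move=> tab ts; have Dc := D_continuous (A12c tab ts) (A21c tab ts).
rewrite /S /sym_part; apply: cvgD.
  exact: (cvg_mulmx (cvg_cst _) Dc).
exact: (cvg_mulmx (cvg_trmx Dc) (cvg_cst _)).
Qed.

Let J_within : {within `[a, b], continuous J}.
Proof.
apply/within_mxP => i j.
exact: (intmx_continuous ab S_continuous S_bounded).
Qed.

Let is_derive_J t : a < t < b -> t \notin s -> is_derive t 1 J (S t).
Proof.
move=> tab ts.
exact: (is_derive_intmx ab S_continuous S_bounded tab (S_continuous tab ts)).
Qed.

Let J_tr t : (J t)^T = J t.
Proof.
apply/matrixP => i j; rewrite !mxE; apply: eq_Rintegral => r _.
by rewrite /S -[in LHS](sym_part_tr P_sym) mxE.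
Qed.

(** The integral is estimated by integrating the estimate of the integrand. *)
Let dot_J_le t (x1 y1 : 'cV[R]_n1) (x2 y2 : 'cV[R]_n2) : a <= t <= b ->
  dot (col_mx x1 x2) (J t *m col_mx y1 y2) <= (t - a) *
    sym_part_bound P g12 g21 (enorm x1) (enorm x2) (enorm y1) (enorm y2).
Proof.
move=> /andP[at0 tb]; set c := sym_part_bound _ _ _ _ _ _ _.
have sub : `[a, t] `<=` `[a, b] by apply: subset_itvl; rewrite bnd_simp.
pose f r := dot (col_mx x1 x2) (J r *m col_mx y1 y2).
have := @ler_except _ f (fun r => c * (r - a)) s a t at0.
rewrite subrr mulr0 subr0 /f /J intmx_aa mul0mx dot0r subr0 mulrC; apply.
- apply: continuous_subspaceW sub _; apply: within_dot.
    by apply: continuous_subspaceT => r; exact: cvg_cst.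
  apply: within_mulmx; first exact: J_within.
  by apply: continuous_subspaceT => r; exact: cvg_cst.
- apply: continuous_subspaceT => r; apply: cvgM; first exact: cvg_cst.
  by apply: cvgB; [exact: cvg_id|exact: cvg_cst].
- move=> r /andP[ar rt] rs; have rab : a < r < b by rewrite ar (lt_le_trans rt).
  exists (dot (col_mx x1 x2) (S r *m col_mx y1 y2)), c; split.
  + apply: (is_derive_eq (is_derive_dot (is_derive_cst (col_mx x1 x2) r 1)
      (is_derive_mulmxr (col_mx y1 y2) (is_derive_J rab rs)))).
    by rewrite dotC dot0r add0r.
  + apply: (is_derive_eq (is_deriveM (is_derive_cst c r 1)
      (is_deriveB (is_derive_id r 1) (is_derive_cst a r 1)))).
    by rewrite /GRing.scale/= mulr0 addr0 subr0 mulr1.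
  + by apply: dot_sym_part_le => //; [exact: A12g|exact: A21g].
Qed.

Let Pi := Pimx (b - a) g12 g21 P.
Hypothesis Pi_posdef : posdefmx Pi.

Let W t := P - J t.

Let dot_W_ge t y : a <= t <= b -> dot y (Pi *m y) <= dot y (W t *m y).
Proof.
move=> tab; rewrite -(vsubmxK y); apply: (@dot_Pimx_le _ _ _ _ _ _ _ _ _ (t - a)) => //.
  by move: tab => /andP[at0 tb]; rewrite subr_ge0 at0 lerD2r.
exact: dot_J_le.
Qed.

(** The block-diagonal part of the system is removed by the change of variable
    [y = blockexp r *m x]. *)
Definition blockexp (r : R) : 'M[R]_(n1 + n2) :=
  block_mx (expmx (- (r *: A11))) 0 0 (expmx (- (r *: A22))).

Let E := blockexp.
Let F r : 'M[R]_(n1 + n2) := block_mx (expmx (r *: A11)) 0 0 (expmx (r *: A22)).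

Let FE r : F r *m E r = 1%:M.
Proof.
rewrite mulmx_block !mulmx0 !mul0mx !addr0 !add0r !expmx_mulN.
by rewrite -scalar_mx_block.
Qed.

Let E0 : E 0 = 1%:M.
Proof. by rewrite /E /blockexp !scale0r !oppr0 !expmx0 -scalar_mx_block. Qed.

Let is_derive_E (r : R) : is_derive r 1 E (- (E r *m block_mx A11 0 0 A22)).
Proof.
apply: (is_derive_eq (is_derive_block_mx (is_derive_expmxN A11 r)
  (is_derive_expmxN A22 r))).
by rewrite mulmx_block !mulmx0 !mul0mx !addr0 !add0r opp_block_mx !oppr0.
Qed.

(** The matrix of the form [y^T W y] at time [b] in the original variable. *)
Definition next_mx : 'M[R]_(n1 + n2) := (E (b - a))^T *m W b *m E (b - a).

Let W_tr t : (W t)^T = W t.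
Proof. by rewrite /W linearB/= P_sym J_tr. Qed.

Let dot_next_mx x : dot x (next_mx *m x) = dot (E (b - a) *m x) (W b *m (E (b - a) *m x)).
Proof. by rewrite dot_mulmxl !mulmxA. Qed.

(** [W] dominates the positive definite matrix [Pi], and [E] is invertible. *)
Lemma next_mx_posdef : posdefmx next_mx.
Proof.
split=> [|x x0]; first by rewrite /next_mx !trmx_mul trmxK W_tr mulmxA.
have -> : (x^T *m next_mx *m x) ord0 ord0 = dot x (next_mx *m x).
  by rewrite /dot mulmxA.
rewrite dot_next_mx; have := @dot_W_ge b (E (b - a) *m x).
rewrite lexx ltW// => /(_ isT); apply: lt_le_trans.
apply: (posdefmx_dot Pi_posdef); apply: contra_neq x0 => Ex0.
have <- : F (b - a) *m (E (b - a) *m x) = x by rewrite mulmxA FE mul1mx.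
by rewrite [X in _ *m X]Ex0 mulmx0.
Qed.

Let conj_bound_le m n (X : 'M[R]_m) (Y : 'M[R]_n) (Q : 'M[R]_(m, n)) N de g M mu r v :
  0 <= r -> opnorm (expmx (- (r *: X))) <= N * expR (r * de) -> opnorm Q <= g ->
  opnorm (expmx (r *: Y)) <= M * expR (r * mu) ->
  enorm (expmx (- (r *: X)) *m (Q *m (expmx (r *: Y) *m v))) <=
  conj_bound N de g M mu r * enorm v.
Proof.
move=> r0 XN Qg YM; rewrite /conj_bound -!mulrA.
rewrite (le_trans (enorm_mulmx _ _))// mulrA ler_pM ?opnorm_ge0 ?enorm_ge0//.
rewrite (le_trans (enorm_mulmx _ _))// ler_pM ?opnorm_ge0 ?enorm_ge0//.
rewrite (le_trans (enorm_mulmx _ _))// mulrA ler_pM ?opnorm_ge0 ?enorm_ge0//.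
Qed.

(** Subtract and add [expmx (- (r *: X)) *m Q *m v]. *)
Let conj_defect_le m n (X : 'M[R]_m) (Y : 'M[R]_n) (Q : 'M[R]_(m, n)) N de g M mu r v :
  de != 0 -> mu != 0 -> 0 <= r ->
  (forall r : R, 0 <= r -> opnorm (expmx (- (r *: X))) <= N * expR (r * de)) ->
  opnorm Q <= g ->
  (forall r : R, 0 <= r -> opnorm (expmx (r *: Y)) <= M * expR (r * mu)) ->
  enorm (expmx (- (r *: X)) *m (Q *m (expmx (r *: Y) *m v)) - Q *m v) <=
  conj_defect (opnorm X) N de g (opnorm Y) M mu r * enorm v.
Proof.
move=> de0 mu0 r0 XN Qg YM.
rewrite (_ : _ - _ = expmx (- (r *: X)) *m (Q *m (expmx (r *: Y) *m v - v)) +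
    (expmx (- (r *: X)) *m (Q *m v) - Q *m v)); last first.
  by rewrite !mulmxBr addrA subrK.
rewrite (le_trans (enormD _ _))// /conj_defect mulrDl lerD//.
  rewrite -!mulrA (le_trans (enorm_mulmx _ _))//.
  rewrite mulrA ler_pM ?opnorm_ge0 ?enorm_ge0 ?XN//.
  rewrite (le_trans (enorm_mulmx _ _))// ler_pM ?opnorm_ge0 ?enorm_ge0//.
  by have := expmx_sub1_le v mu0 r0 YM; rewrite -!mulrA.
have XN' : forall r : R, 0 <= r -> opnorm (expmx (r *: - X)) <= N * expR (r * de).
  by move=> u u0; rewrite scalerN XN.
have := expmx_sub1_le (Q *m v) de0 r0 XN'.
rewrite scalerN opnormN => /le_trans; apply.
have N0 : 0 <= N.
  have := XN _ (lexx 0); rewrite mul0r expR0 mulr1; exact: le_trans (opnorm_ge0 _).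
rewrite -[leRHS]mulrA; apply: ler_wpM2l.
  by rewrite mulr_ge0 ?expprim_ge0// mulr_ge0 ?opnorm_ge0.
by rewrite (le_trans (enorm_mulmx _ _))// ler_wpM2r ?enorm_ge0.
Qed.

Let N1_ge0 : 0 <= N1.
Proof.
have := expNA11 (lexx 0); rewrite mul0r expR0 mulr1.
exact: le_trans (opnorm_ge0 _).
Qed.

Let N2_ge0 : 0 <= N2.
Proof.
have := expNA22 (lexx 0); rewrite mul0r expR0 mulr1.
exact: le_trans (opnorm_ge0 _).
Qed.

Let M1_ge0 : 0 <= M1.
Proof.
have := expA11 (lexx 0); rewrite mul0r expR0 mulr1.
exact: le_trans (opnorm_ge0 _).
Qed.

Let M2_ge0 : 0 <= M2.
Proof.
have := expA22 (lexx 0); rewrite mul0r expR0 mulr1.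
exact: le_trans (opnorm_ge0 _).
Qed.

Let conj_bound_ge0 (N de g M mu r : R) : 0 <= N -> 0 <= g -> 0 <= M ->
  0 <= conj_bound N de g M mu r.
Proof. by move=> *; rewrite /conj_bound !mulr_ge0 ?expR_ge0. Qed.

Let conj_defect_ge0 (p N de g p' M mu r : R) :
  0 <= r -> 0 <= p -> 0 <= N -> 0 <= g -> 0 <= p' -> 0 <= M ->
  0 <= conj_defect p N de g p' M mu r.
Proof.
move=> *; have ? := expprim_ge0 mu; have ? := expprim_ge0 de.
rewrite /conj_defect addr_ge0//.
  rewrite mulr_ge0//; first by rewrite mulr_ge0 ?expR_ge0.
  by rewrite mulr_ge0// mulr_ge0 ?expprim_ge0// mulr_ge0.
by rewrite mulr_ge0// mulr_ge0 ?expprim_ge0// mulr_ge0.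
Qed.

Let rate := theta_rate A11 A22 mu1 mu2 delta1 delta2 M1 M2 N1 N2 g12 g21 P.

Let rate_ge0 r : 0 <= r -> 0 <= rate r.
Proof.
move=> r0; rewrite /rate /theta_rate.
have d12 : 0 <= conj_defect (opnorm A11) N1 delta1 g12 (opnorm A22) M2 mu2 r.
  by apply: conj_defect_ge0; rewrite ?opnorm_ge0.
have d21 : 0 <= conj_defect (opnorm A22) N2 delta2 g21 (opnorm A11) M1 mu1 r.
  by apply: conj_defect_ge0; rewrite ?opnorm_ge0.
have c12 : 0 <= conj_bound N1 delta1 g12 M2 mu2 r by apply: conj_bound_ge0.
have c21 : 0 <= conj_bound N2 delta2 g21 M1 mu1 r by apply: conj_bound_ge0.
have q0 : 0 <= opnorm (ulsubmx P) * g12 + opnorm (drsubmx P) * g21.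
  by rewrite addr_ge0// mulr_ge0 ?opnorm_ge0.
have s0 x : 0 <= Num.sqrt x :> R by exact: sqrtr_ge0.
rewrite addr_ge0//; last first.
  apply: mulr_ge0; first by rewrite mulr_ge0.
  by apply: addr_ge0; apply: mulr_ge0 => //; apply: mulr_ge0; rewrite ?invr_ge0// addr_ge0.
by apply: addr_ge0; apply: mulr_ge0 => //; rewrite addr_ge0 ?opnorm_ge0.
Qed.

Section Trajectory.
Variable z : R -> 'cV[R]_(n1 + n2).
Hypothesis z_within : {within `[a, b], continuous z}.
Hypothesis z_deriv : forall t, a < t < b -> t \notin s ->
  is_derive t 1 z (block_mx A11 (A12 t) (A21 t) A22 *m z t).

Let y t := E (t - a) *m z t.
Let v t := dot (y t) (W t *m y t).

Let y1 t := expmx (- ((t - a) *: A11)) *m usubmx (z t).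
Let y2 t := expmx (- ((t - a) *: A22)) *m dsubmx (z t).

Let yE t : y t = col_mx (y1 t) (y2 t).
Proof.
by rewrite /y /E /blockexp -[in LHS](vsubmxK (z t)) mul_block_col !mul0mx addr0 add0r.
Qed.

Let w1 t := expmx (- ((t - a) *: A11)) *m (A12 t *m (expmx ((t - a) *: A22) *m y2 t)).
Let w2 t := expmx (- ((t - a) *: A22)) *m (A21 t *m (expmx ((t - a) *: A11) *m y1 t)).

Let w1E t : w1 t = expmx (- ((t - a) *: A11)) *m (A12 t *m dsubmx (z t)).
Proof. by congr (_ *m (_ *m _)); exact: expmx_mulNK. Qed.

Let w2E t : w2 t = expmx (- ((t - a) *: A22)) *m (A21 t *m usubmx (z t)).
Proof. by congr (_ *m (_ *m _)); exact: expmx_mulNK. Qed.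

Let is_derive_y t : a < t < b -> t \notin s ->
  is_derive t 1 y (col_mx (w1 t) (w2 t)).
Proof.
move=> tab ts; have Ed := @is_derive_mx_shift _ _ _ E a t _ (is_derive_E (t - a)).
apply: (is_derive_eq (is_derive_mulmx Ed (z_deriv tab ts))).
rewrite w1E w2E.
have -> : block_mx A11 (A12 t) (A21 t) A22 = block_mx A11 0 0 A22 + D t.
  by rewrite /D /offdiag_mx add_block_mx !addr0 !add0r.
rewrite mulmxDl mulmxDr !mulmxA mulNmx addKr -mulmxA /D.
rewrite -[in LHS](vsubmxK (z t)) offdiag_mx_col /E /blockexp mul_block_col.
by rewrite !mul0mx addr0 add0r !mulmxA.
Qed.

(** [- S], the derivative of [W], and the part [2 y^T P D y] of the contribution of
    [y'] cancel. *)
Let is_derive_v t : a < t < b -> t \notin s ->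
  is_derive t 1 v (2 * dot (P *m y t) (col_mx (w1 t) (w2 t) - D t *m y t) +
    2 * dot (y t) (J t *m - col_mx (w1 t) (w2 t))).
Proof.
move=> tab ts; have yd := is_derive_y tab ts.
have Wd : is_derive t 1 W (- S t).
  apply: (is_derive_eq (is_deriveB (is_derive_cst P t 1) (is_derive_J tab ts))).
  by rewrite sub0r.
apply: (is_derive_eq (is_derive_dot yd (is_derive_mulmx Wd yd))).
set w := col_mx _ _.
rewrite dotDr mulNmx dotNr dot_sym_part//.
rewrite [dot w _]dotC -[in dot (y t) (W t *m w)]W_tr -dot_mulmxl.
rewrite [in RHS]mulmxN dotNr dotBr -[in J t *m w]J_tr -(dot_mulmxl (J t)).
rewrite /W !mulmxBl !dotBl; ring.
Qed.

Let v_deriv_le t : a < t < b ->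
  2 * dot (P *m y t) (col_mx (w1 t) (w2 t) - D t *m y t) +
    2 * dot (y t) (J t *m - col_mx (w1 t) (w2 t)) <=
  rate (t - a) / lambda_min Pi * v t.
Proof.
move=> tab; have /andP[/ltW at0 /ltW tb] := tab.
have r0 : 0 <= t - a by rewrite subr_ge0.
have [lam0 lamP] := lambda_minP (ltn_addr n2 n1_gt0) Pi_posdef.
apply: (@le_trans _ _ (rate (t - a) * dot (y t) (y t))); last first.
  rewrite -mulrA ler_wpM2l ?rate_ge0// ler_pdivlMl//.
  by rewrite (le_trans (lamP _))// dot_W_ge// at0.
have d12 : 0 <= conj_defect (opnorm A11) N1 delta1 g12 (opnorm A22) M2 mu2 (t - a).
  by apply: conj_defect_ge0; rewrite ?opnorm_ge0.
have d21 : 0 <= conj_defect (opnorm A22) N2 delta2 g21 (opnorm A11) M1 mu1 (t - a).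
  by apply: conj_defect_ge0; rewrite ?opnorm_ge0.
have c12 : 0 <= conj_bound N1 delta1 g12 M2 mu2 (t - a) by apply: conj_bound_ge0.
have c21 : 0 <= conj_bound N2 delta2 g21 M1 mu1 (t - a) by apply: conj_bound_ge0.
rewrite yE dot_col_mx -!enorm_sqr /D offdiag_mx_col.
rewrite opp_col_mx add_col_mx.
have H1 := dot_defect_le P_sym d12 d21
  (conj_defect_le (y2 t) delta1_neq0 mu2_neq0 r0 expNA11 (A12g tab) expA22)
  (conj_defect_le (y1 t) delta2_neq0 mu1_neq0 r0 expNA22 (A21g tab) expA11).
have tab' : a <= t <= b by rewrite at0.
have H2 := dot_J_le (y1 t) (- w1 t) (y2 t) (- w2 t) tab'.
rewrite opp_col_mx.
have w1le : enorm (- w1 t) <= conj_bound N1 delta1 g12 M2 mu2 (t - a) * enorm (y2 t).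
  rewrite enormN.
  exact: (conj_bound_le (y2 t) r0 (expNA11 r0) (A12g tab) (expA22 r0)).
have w2le : enorm (- w2 t) <= conj_bound N2 delta2 g21 M1 mu1 (t - a) * enorm (y1 t).
  rewrite enormN.
  exact: (conj_bound_le (y1 t) r0 (expNA22 r0) (A21g tab) (expA11 r0)).
have H3 := sym_part_bound_le P g12_ge0 g21_ge0 c12 c21
  (enorm_ge0 (y1 t)) (enorm_ge0 (y2 t)) w1le w2le.
have H4 := le_trans H2 (ler_wpM2l r0 H3).
have factorE (c r k x : R) : c * x + 2 * (r * (k * x)) = (c + 2 * r * k) * x.
  by ring.
by have := lerD H1 (ler_wpM2l (ler0n _ 2) H4); rewrite factorE.
Qed.

(** Gronwall's inequality for [v], whose logarithmic derivative is at most that of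
    [expR (Theta / lambda_min Pi)]. *)
Lemma lyapunov_step :
  dot (z b) (next_mx *m z b) <=
  expR (Theta A11 A22 mu1 mu2 delta1 delta2 M1 M2 N1 N2 (b - a) g12 g21 P
    / lambda_min Pi) * dot (z a) (P *m z a).
Proof.
pose Th r := Theta A11 A22 mu1 mu2 delta1 delta2 M1 M2 N1 N2 r g12 g21 P.
have Th_d (t : R) : is_derive t 1 (fun t => Th (t - a) / lambda_min Pi)
    (rate (t - a) / lambda_min Pi).
  have sd : is_derive t 1 (fun u : R => u - a) 1.
    by apply: is_derive_eq; rewrite subr0.
  have td := @is_derive1_comp _ Th (fun u => u - a) t _ _
    (is_derive_Theta A11 A22 M1 M2 N1 N2 g12 g21 P mu1_neq0 mu2_neq0 delta1_neq0
      delta2_neq0 mu2_delta1_neq0 mu1_delta2_neq0 (t - a)) sd.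
  apply: (is_derive_eq (is_deriveM td (is_derive_cst ((lambda_min Pi)^-1 : R) t 1))).
  by rewrite /GRing.scale/= mulr0 add0r mulr1 mulrC.
have := @gronwall_except _ v (fun t => Th (t - a) / lambda_min Pi) s a b (ltW ab).
rewrite subrr /Th Theta0 mul0r subr0.
have -> : v a = dot (z a) (P *m z a).
  by rewrite /v /y subrr E0 mul1mx /W /J intmx_aa subr0.
have -> : v b = dot (z b) (next_mx *m z b) by rewrite dot_next_mx.
apply.
- have Ew : {within `[a, b], continuous (fun t => E (t - a))}.
    apply: is_derive_within => t.
    exact: (@is_derive_mx_shift _ _ _ E a t _ (is_derive_E (t - a))).
  have yw : {within `[a, b], continuous y} by exact: within_mulmx Ew z_within.
  have Ww : {within `[a, b], continuous W}.
    by move=> t; apply: cvgB; [exact: cvg_cst|exact: J_within].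
  exact: (within_dot yw (within_mulmx Ww yw)).
- apply: continuous_subspaceT => t; have td := Th_d t.
  exact/differentiable_continuous/derivable1_diffP.
- move=> t tab ts; do 2 eexists; split; [exact: is_derive_v|exact: Th_d|].
  exact: v_deriv_le.
Qed.

End Trajectory.

End LyapunovPiece.

(** * The recursion for the matrices in block form *)

Section PStep.
Context {R : realType} {n1 n2 : nat}.
Variables (A11 : 'M[R]_n1) (A12 : R -> 'M[R]_(n1, n2))
          (A21 : R -> 'M[R]_(n2, n1)) (A22 : 'M[R]_n2).

Lemma intmx_block a b (F : R -> 'M[R]_(n1 + n2)) :
  intmx a b F = block_mx
    (intmx a b (fun t => ulsubmx (F t))) (intmx a b (fun t => ursubmx (F t)))
    (intmx a b (fun t => dlsubmx (F t))) (intmx a b (fun t => drsubmx (F t))).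
Proof.
rewrite -[LHS]submxK; congr block_mx; apply/matrixP => i j; rewrite !mxE;
  by apply: eq_Rintegral => t _; rewrite !mxE.
Qed.

Lemma intmx_tr m n a b (F : R -> 'M[R]_(m, n)) :
  (intmx a b F)^T = intmx a b (fun t => (F t)^T).
Proof.
by apply/matrixP => i j; rewrite !mxE; apply: eq_Rintegral => t _; rewrite mxE.
Qed.

(** For symmetric [P] the three recursion formulas are the blocks of a single one
    for the whole matrix. *)
Lemma P_stepE h m (P : 'M[R]_(n1 + n2)) : P^T = P ->
  P_step A11 A12 A21 A22 h m P =
  next_mx A11 A12 A21 A22 P (m%:R * h) (m.+1%:R * h).
Proof.
move=> P_sym; rewrite /next_mx.
have -> : m.+1%:R * h - m%:R * h = h by rewrite -mulrBl -natrB// subSnn mul1r.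
have dlE : dlsubmx P = (ursubmx P)^T by rewrite trmx_ursub P_sym.
have Eul : (ulsubmx P)^T = ulsubmx P by rewrite trmx_ulsub P_sym.
have Edr : (drsubmx P)^T = drsubmx P by rewrite trmx_drsub P_sym.
have SE t : sym_part P (offdiag_mx (A12 t) (A21 t)) = block_mx
    (ursubmx P *m A21 t + (A21 t)^T *m (ursubmx P)^T)
    (ulsubmx P *m A12 t + (A21 t)^T *m drsubmx P)
    (ulsubmx P *m A12 t + (A21 t)^T *m drsubmx P)^T
    ((A12 t)^T *m ursubmx P + (ursubmx P)^T *m A12 t).
  rewrite /sym_part /offdiag_mx -{1 2}[P]submxK dlE tr_block_mx !mulmx_block.
  rewrite !trmx0 !mulmx0 !mul0mx !addr0 !add0r add_block_mx.
  rewrite [in RHS]linearD/= !trmx_mul trmxK Eul Edr.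
  by congr block_mx; rewrite addrC.
rewrite /P_step intmx_block.
under [X in block_mx (intmx _ _ X)]eq_fun do rewrite SE block_mxKul.
under [X in block_mx _ (intmx _ _ X)]eq_fun do rewrite SE block_mxKur.
under [X in block_mx _ _ (intmx _ _ X)]eq_fun do rewrite SE block_mxKdl.
under [X in block_mx _ _ _ (intmx _ _ X)]eq_fun do rewrite SE block_mxKdr.
rewrite -intmx_tr.
set I11 := intmx _ _ (fun t => ursubmx P *m A21 t + _).
set I12 := intmx _ _ (fun t => ulsubmx P *m A12 t + _).
set I22 := intmx _ _ (fun t => (A12 t)^T *m ursubmx P + _).
have -> : P - block_mx I11 I12 I12^T I22 = block_mx (ulsubmx P - I11)
    (ursubmx P - I12) (ursubmx P - I12)^T (drsubmx P - I22).
  by rewrite -{1}[P]submxK dlE opp_block_mx add_block_mx [in RHS]linearB.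
have expT n (A : 'M[R]_n) : expmx (- (h *: A^T)) = (expmx (- (h *: A)))^T.
  by rewrite -expmx_tr [in RHS]linearN [in RHS]linearZ.
rewrite !expT /blockexp tr_block_mx !trmx0 !mulmx_block.
rewrite !mul0mx !mulmx0 !addr0 !add0r.
by congr block_mx; rewrite !trmx_mul trmxK mulmxA.
Qed.

End PStep.

(** * Trajectories between two impulses *)

Section OneSidedLimits.
Context {R : realType} {n : nat}.
Implicit Types (x : R -> 'cV[R]_n) (a b c : R).

Lemma cvg_at_right_shift x a c (L : 'cV[R]_n) :
  x @ (a + c)^'+ --> L -> x (t + c) @[t --> a^'+] --> L.
Proof.
move=> xL; have sc : (t + c : R) @[t --> a^'+] --> (a + c)^'+.
  move=> A /nbhs_right0P A0; apply/nbhs_right0P; move: A0.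
  by apply: filterS => e; rewrite /= addrAC.
exact: cvg_comp sc xL.
Qed.

Lemma cvg_at_left_shift x a c (L : 'cV[R]_n) :
  x @ (a + c)^'- --> L -> x (t + c) @[t --> a^'-] --> L.
Proof.
move=> xL; have sc : (t + c : R) @[t --> a^'-] --> (a + c)^'-.
  move=> A /nbhs_left0P A0; apply/nbhs_left0P; move: A0.
  by apply: filterS => e; rewrite /= addrAC.
exact: cvg_comp sc xL.
Qed.

(** A trajectory jumps at an impulse, to the right limit [L]. Giving it the value
    [L] there makes it continuous on the closed interval that follows; the shift
    by [c] moves this interval to the first period. *)
Definition restart x a c (L : 'cV[R]_n) (t : R) : 'cV[R]_n :=
  if t <= a then L else x (t + c).

Lemma restart_within x a b c L : a < b ->
  x @ (a + c)^'+ --> L ->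
  (forall t, a < t <= b -> x @ (t + c)^'- --> x (t + c)) ->
  (forall t, a < t < b -> x @ (t + c)^'+ --> x (t + c)) ->
  {within `[a, b], continuous (restart x a c L)}.
Proof.
move=> ab xa xl xr; apply/within_mxP => i j.
have entry F (FF : Filter F) (f : R -> 'cV[R]_n) (M : 'cV[R]_n) :
    f @ F --> M -> f t i j @[t --> F] --> M i j.
  by move=> /cvg_mxP; apply.
have near_gt (r : R) : a < r -> \forall t \near r, restart x a c L t = x (t + c).
  move=> ar; near=> t; rewrite /restart leNgt ifF//.
  apply/negbF; near: t; exact: lt_nbhsr.
apply/(continuous_within_itvP _ ab); split.
- move=> t; rewrite in_itv/= => /andP[ta tb].
  have tab : a < t < b by rewrite ta.
  have tab' : a < t <= b by rewrite ta ltW.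
  have : x (u + c) @[u --> t] --> x (t + c).
    apply/left_right_continuousP; split.
      exact/cvg_at_left_shift/xl.
    exact/cvg_at_right_shift/xr.
  have -> : x (t + c) = restart x a c L t by rewrite /restart leNgt ta.
  move=> /entry; apply: cvg_trans; apply: near_eq_cvg.
  by near=> u; rewrite (near (near_gt t ta) u).
- rewrite {2}/restart lexx; have /entry := cvg_at_right_shift xa.
  apply: cvg_trans; apply: near_eq_cvg.
  near=> t; rewrite /restart leNgt; have -> // : a < t.
  by near: t; exact: nbhs_right_gt.
- rewrite /=; have -> : restart x a c L b = x (b + c) by rewrite /restart leNgt ab.
  have abb : a < b <= b by rewrite ab lexx.
  have /entry := cvg_at_left_shift (xl _ abb).
  apply: cvg_trans; apply: near_eq_cvg.
  near=> t; rewrite /restart leNgt; have -> // : a < t.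
  by near: t; exact: nbhs_left_gt.
Unshelve. all: by end_near. Qed.

Lemma is_derive_restart x a c L t dx : a < t ->
  is_derive (t + c) 1 x dx -> is_derive t 1 (restart x a c L) dx.
Proof.
move=> ta xd; have := @is_derive_mx_shift _ _ _ x (- c) t dx.
rewrite opprK => /(_ xd); apply: near_eq_is_derive.
near=> u; rewrite /restart leNgt; have -> // : a < u.
by near: u; exact: lt_nbhsr.
Unshelve. all: by end_near. Qed.

End OneSidedLimits.

(** Coarse growth estimate, from Gronwall's inequality for [enorm ^+ 2]. *)
Lemma coarse_growth (R : realType) n (A : R -> 'M[R]_n) (z : R -> 'cV[R]_n)
    (s : seq R) (a b K : R) : a <= b ->
  {within `[a, b], continuous z} ->
  (forall t, a < t < b -> t \notin s -> is_derive t 1 z (A t *m z t)) ->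
  (forall t y, a < t < b -> dot y (A t *m y) <= K * dot y y) ->
  dot (z b) (z b) <= expR (2 * K * (b - a)) * dot (z a) (z a).
Proof.
move=> ab zw zd AK.
have := @gronwall_except _ (fun t => dot (z t) (z t)) (fun t => 2 * K * t) s a b ab.
rewrite -mulrBr; apply.
- exact: within_dot.
- by apply: continuous_subspaceT => t; apply: cvgM; [exact: cvg_cst|exact: cvg_id].
- move=> t tab ts; do 2 eexists; split.
  + exact: is_derive_dot (zd _ tab ts) (zd _ tab ts).
  + exact: (is_deriveM (is_derive_cst (2 * K) t 1) (is_derive_id t 1)).
  + rewrite /GRing.scale/= mulr0 addr0 mulr1 [dot (A t *m z t) _]dotC.
    by have := AK t (z t) tab; lra.
Qed.

(** * Stability of the impulsive system *)

Lemma piecewise_continuous_seq (R : realType) m n (F : R -> 'M[R]_(m, n)) (a b : R) :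
  piecewise_continuous F ->
  exists s : seq R, forall t, a <= t <= b -> t \notin s -> {for t, continuous F}.
Proof.
move=> [/(_ a b)/finite_seqP[s sE] _]; exists s => t tab ts.
apply: contrapT => Ft; move/negP: ts; apply.
suff : [set` s] t by [].
by rewrite -sE.
Qed.

Section Stability.
Context {R : realType} {n1 n2 : nat}.
Hypotheses (n1_gt0 : (0 < n1)%N).
Variables (A11 : 'M[R]_n1) (A12 : R -> 'M[R]_(n1, n2))
          (A21 : R -> 'M[R]_(n2, n1)) (A22 : 'M[R]_n2) (B : 'M[R]_(n1 + n2)).
Variables (theta : R) (N : nat).
Hypotheses (theta_gt0 : 0 < theta) (N_gt0 : (0 < N)%N).
Hypotheses (A12_pc : piecewise_continuous A12) (A21_pc : piecewise_continuous A21)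
  (A12_per : forall t : R, A12 (t + theta) = A12 t)
  (A21_per : forall t : R, A21 (t + theta) = A21 t).
Variables (mu1 mu2 delta1 delta2 M1 M2 N1 N2 : R).
Hypotheses (expA11 : forall r : R, 0 <= r ->
    opnorm (expmx (r *: A11)) <= M1 * expR (r * mu1))
  (expA22 : forall r : R, 0 <= r ->
    opnorm (expmx (r *: A22)) <= M2 * expR (r * mu2))
  (expNA11 : forall r : R, 0 <= r ->
    opnorm (expmx (- (r *: A11))) <= N1 * expR (r * delta1))
  (expNA22 : forall r : R, 0 <= r ->
    opnorm (expmx (- (r *: A22))) <= N2 * expR (r * delta2)).
Hypotheses (mu1_neq0 : mu1 != 0) (mu2_neq0 : mu2 != 0)
  (delta1_neq0 : delta1 != 0) (delta2_neq0 : delta2 != 0)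
  (mu2_delta1_neq0 : mu2 + delta1 != 0) (mu1_delta2_neq0 : mu1 + delta2 != 0).
Variables (gamma12 gamma21 : nat -> R) (P0 : 'M[R]_(n1 + n2)).
Hypotheses (gamma12_gt0 : forall m, (m < N)%N -> 0 < gamma12 m)
  (gamma21_gt0 : forall m, (m < N)%N -> 0 < gamma21 m) (P0_posdef : posdefmx P0).

Let h := theta / N%:R.
Let P := Pmx A11 A12 A21 A22 h P0.
Let Pi m := Pimx h (gamma12 m) (gamma21 m) (P m).
Let Th m := Theta A11 A22 mu1 mu2 delta1 delta2 M1 M2 N1 N2 h
  (gamma12 m) (gamma21 m) (P m).

Hypotheses (A12_le : forall m t, (m < N)%N -> m%:R * h < t <= m.+1%:R * h ->
    opnorm (A12 t) <= gamma12 m)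
  (A21_le : forall m t, (m < N)%N -> m%:R * h < t <= m.+1%:R * h ->
    opnorm (A21 t) <= gamma21 m)
  (Pi_posdef : forall m, (m < N)%N -> posdefmx (Pi m)).

Let h_gt0 : 0 < h.
Proof. by rewrite divr_gt0// ltr0n. Qed.

Let Nh : N%:R * h = theta.
Proof. by rewrite mulrC divfK// pnatr_eq0 -lt0n. Qed.

Let stepE m : m.+1%:R * h - m%:R * h = h.
Proof. by rewrite -mulrBl -natrB// subSnn mul1r. Qed.

Let step_lt m : m%:R * h < m.+1%:R * h.
Proof. by rewrite ltr_pM2r// ltr_nat. Qed.

Let step_in m t : (m < N)%N -> m%:R * h < t < m.+1%:R * h -> 0 < t < theta.
Proof.
move=> mN /andP[mt tm]; apply/andP; split.
  by apply: le_lt_trans mt; rewrite mulr_ge0 ?ler0n// ltW.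
by apply: lt_le_trans tm _; rewrite -Nh ler_pM2r// ler_nat.
Qed.

Lemma Pmx_posdef m : (m <= N)%N -> posdefmx (P m).
Proof.
elim: m => [//|m IHm] mN; have Pm := IHm (ltnW mN).
have [s12 c12] := piecewise_continuous_seq 0 theta A12_pc.
have [s21 c21] := piecewise_continuous_seq 0 theta A21_pc.
rewrite /P /= -/P P_stepE ?Pm.1//.
have tin t : m%:R * h < t < m.+1%:R * h -> 0 <= t <= theta.
  by move=> /(step_in mN)/andP[/ltW-> /ltW->].
apply: (@next_mx_posdef _ _ _ _ _ _ _ (gamma12 m) (gamma21 m) _ _ _ (s12 ++ s21)).
- exact/ltW/gamma12_gt0.
- exact/ltW/gamma21_gt0.
- exact: Pm.1.
- exact: step_lt.
- by move=> t /tin tT; rewrite mem_cat negb_or => /andP[ts _]; exact: c12.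
- by move=> t /tin tT; rewrite mem_cat negb_or => /andP[_ ts]; exact: c21.
- by move=> t /andP[mt /ltW tm]; apply: A12_le => //; rewrite mt.
- by move=> t /andP[mt /ltW tm]; apply: A21_le => //; rewrite mt.
- by rewrite stepE; exact: Pi_posdef.
Qed.

Let A t := block_mx A11 (A12 t) (A21 t) A22.

(** One trajectory [z] serves for all subintervals, since it is continuous where
    they meet; the growth factors are multiplied. *)
Let chain (z : R -> 'cV[R]_(n1 + n2)) (s : seq R) m :
  {within `[0, theta], continuous z} ->
  (forall t, 0 < t < theta -> t \notin s ->
    [/\ {for t, continuous A12}, {for t, continuous A21} &
        is_derive t 1 z (A t *m z t)]) ->
  (m <= N)%N ->
  dot (z (m%:R * h)) (P m *m z (m%:R * h)) <=
  expR (\sum_(i < m) Th i / lambda_min (Pi i)) * dot (z 0) (P0 *m z 0).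
Proof.
move=> zw zd; elim: m => [_|m IHm mN].
  by rewrite mul0r big_ord0 expR0 mul1r.
have Pm := Pmx_posdef (ltnW mN).
rewrite big_ord_recr/= addrC expRD -mulrA.
apply: le_trans (ler_wpM2l (expR_ge0 _) (IHm (ltnW mN))).
rewrite /P /= -/P P_stepE ?Pm.1//.
have tin t : m%:R * h < t < m.+1%:R * h -> 0 < t < theta by exact: step_in mN.
have Pi_m : posdefmx (Pimx (m.+1%:R * h - m%:R * h) (gamma12 m) (gamma21 m) (P m)).
  by rewrite stepE; exact: Pi_posdef.
have c12 t : m%:R * h < t < m.+1%:R * h -> t \notin s -> {for t, continuous A12}.
  by move=> /tin tT ts; have [] := zd t tT ts.
have c21 t : m%:R * h < t < m.+1%:R * h -> t \notin s -> {for t, continuous A21}.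
  by move=> /tin tT ts; have [] := zd t tT ts.
have l12 t : m%:R * h < t < m.+1%:R * h -> opnorm (A12 t) <= gamma12 m.
  by move=> /andP[mt /ltW tm]; apply: A12_le => //; rewrite mt.
have l21 t : m%:R * h < t < m.+1%:R * h -> opnorm (A21 t) <= gamma21 m.
  by move=> /andP[mt /ltW tm]; apply: A21_le => //; rewrite mt.
have zwm : {within `[m%:R * h, m.+1%:R * h], continuous z}.
  apply: continuous_subspaceW zw; apply: subset_itv; rewrite bnd_simp.
    by rewrite mulr_ge0 ?ler0n// ltW.
  by rewrite -Nh ler_pM2r// ler_nat.
have zdm t : m%:R * h < t < m.+1%:R * h -> t \notin s ->
    is_derive t 1 z (block_mx A11 (A12 t) (A21 t) A22 *m z t).
  by move=> /tin tT ts; have [] := zd t tT ts.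
have := lyapunov_step n1_gt0 expA11 expA22 expNA11 expNA22 mu1_neq0 mu2_neq0
  delta1_neq0 delta2_neq0 mu2_delta1_neq0 mu1_delta2_neq0 (ltW (gamma12_gt0 mN))
  (ltW (gamma21_gt0 mN)) Pm.1 (step_lt m) c12 c21 l12 l21 Pi_m zwm zdm.
by rewrite stepE.
Qed.

Let interval_index (r t : R) n : 0 < t <= n%:R * r ->
  exists2 m, (m < n)%N & m%:R * r < t <= m.+1%:R * r.
Proof.
elim: n => [|n IHn] /andP[t0 tn].
  by move: tn; rewrite mul0r leNgt t0.
have [tle|tgt] := leP t (n%:R * r); last by exists n; rewrite // tgt.
have [|m mn tm] := IHn; first by rewrite t0.
by exists m => //; rewrite ltnS ltnW.
Qed.

Let A12_pern t k : A12 (t + k%:R * theta) = A12 t.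
Proof.
elim: k => [|k IHk]; first by rewrite mul0r addr0.
by rewrite -natr1 mulrDl mul1r addrA A12_per.
Qed.

Let A21_pern t k : A21 (t + k%:R * theta) = A21 t.
Proof.
elim: k => [|k IHk]; first by rewrite mul0r addr0.
by rewrite -natr1 mulrDl mul1r addrA A21_per.
Qed.

Let moment_unbounded (t : R) : exists k, t <= k%:R * theta.
Proof.
exists (Num.truncn `|t / theta|).+1.
rewrite -ler_pdivrMr//; apply: le_trans (ler_norm _) _; apply: ltW.
by rewrite truncnS_gt.
Qed.

(** Every [t] is, up to a multiple of the period, in one of the [N] subintervals
    on which bounds are given. *)
Let A_bounded (t : R) :
  opnorm (A12 t) <= \sum_(m < N) gamma12 m /\
  opnorm (A21 t) <= \sum_(m < N) gamma21 m.
Proof.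
have [j tj] := moment_unbounded (1 - t); pose t1 := t + j%:R * theta.
have t10 : 0 < t1 by rewrite /t1; lra.
have [n t1n] := moment_unbounded t1.
have [|i _ /andP[it ti]] := @interval_index theta t1 n; first by rewrite t10.
pose t2 := t1 - i%:R * theta.
have [|m mN t2m] := @interval_index h t2 N.
  by rewrite Nh /t2 subr_gt0 it/=; move: ti; rewrite -natr1; lra.
have t2E : t2 + i%:R * theta = t + j%:R * theta by rewrite subrK.
rewrite -(A12_pern t j) -(A21_pern t j) -t2E A12_pern A21_pern.
split.
  apply: le_trans (A12_le mN t2m) _.
  rewrite (bigD1 (Ordinal mN))//= lerDl sumr_ge0// => p _.
  by rewrite ltW// gamma12_gt0.
apply: le_trans (A21_le mN t2m) _.
rewrite (bigD1 (Ordinal mN))//= lerDl sumr_ge0// => p _.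
by rewrite ltW// gamma21_gt0.
Qed.

Let growth_bound : exists2 K : R, 0 <= K &
  forall t y, dot y (A t *m y) <= K * dot y y.
Proof.
pose G12 := \sum_(m < N) gamma12 m; pose G21 := \sum_(m < N) gamma21 m.
have G120 : 0 <= G12 by apply: le_trans (A_bounded 0).1; exact: opnorm_ge0.
have G210 : 0 <= G21 by apply: le_trans (A_bounded 0).2; exact: opnorm_ge0.
exists (opnorm A11 + opnorm A22 + G12 + G21).
  by rewrite !addr_ge0 ?opnorm_ge0.
move=> t y; rewrite -(vsubmxK y) /A mul_block_col !dot_col_mx !dotDr -!enorm_sqr.
set y1 := usubmx y; set y2 := dsubmx y.
have [a12 a21] := A_bounded t.
have y10 := enorm_ge0 y1; have y20 := enorm_ge0 y2.
have e12 := le_trans (dot_mulmx_ler (A12 t) y1 y2) (ler_wpM2r (mulr_ge0 y10 y20) a12).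
have e21 := le_trans (dot_mulmx_ler (A21 t) y2 y1) (ler_wpM2r (mulr_ge0 y20 y10) a21).
apply: le_trans (lerD (lerD (dot_mulmx_ler A11 y1 y1) e12)
  (lerD e21 (dot_mulmx_ler A22 y2 y2))) _.
rewrite -/G12 -/G21; set a := enorm y1; set b := enorm y2.
have ab : 0 <= a ^+ 2 + b ^+ 2 - a * b.
  by have := sqr_ge0 (a - b); have := mulr_ge0 y10 y20; rewrite -/a -/b; lra.
rewrite -subr_ge0 (_ : _ - _ = opnorm A11 * b ^+ 2 + opnorm A22 * a ^+ 2 +
  (G12 + G21) * (a ^+ 2 + b ^+ 2 - a * b)); last by ring.
rewrite addr_ge0//; last by rewrite mulr_ge0// addr_ge0.
by rewrite addr_ge0// mulr_ge0 ?opnorm_ge0 ?sqr_ge0.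
Qed.

Let no_impulse k t : k%:R * theta < t < k.+1%:R * theta ->
  ~ impulse_moment theta t.
Proof.
move=> /andP[kt tk] [j tE]; move: kt tk; rewrite tE !ltr_pM2r// !ltr_nat.
by move=> kj; rewrite ltnS leqNgt kj.
Qed.

(* [lam] bounds the growth of the quadratic form at an impulse. *)
Variable lam : R.
Hypothesis lamP : forall x, dot x (B^T *m P0 *m B *m x) <= lam * dot x (P N *m x).
Hypothesis lam_ge0 : 0 <= lam.

Let rho := expR (\sum_(m < N) Th m / lambda_min (Pi m)) * lam.
Hypothesis rho_lt1 : rho < 1.

Let rho_ge0 : 0 <= rho.
Proof. by rewrite mulr_ge0 ?expR_ge0. Qed.

Notation sol := (impulsive_solution A11 A12 A21 A22 B theta).

Section Solution.
Variables (t0 : R) (x0 : 'cV[R]_(n1 + n2)) (x : R -> 'cV[R]_(n1 + n2)).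
Hypothesis xsol : sol t0 x0 x.

Let z k := restart x 0 (k%:R * theta) (B *m x (k%:R * theta)).

Let z_shift k (t : R) : 0 < t < theta ->
  k%:R * theta < t + k%:R * theta < k.+1%:R * theta.
Proof. by move=> /andP[? ?]; rewrite -natr1; lra. Qed.

Let z_within k : t0 <= k%:R * theta -> {within `[0, theta], continuous (z k)}.
Proof.
move=> tk; have [_ xl xi xr _] := xsol.
apply: restart_within => //.
- by rewrite add0r; apply: xi => //; exists k.
- move=> t /andP[t_gt0 _]; apply: xl; lra.
- move=> t tT; apply: xr; last exact: (no_impulse (z_shift k tT)).
  by move: tT => /andP[]; lra.
Qed.

Let z_deriv k (s : seq R) : t0 <= k%:R * theta ->
  (forall t, 0 <= t <= theta -> t \notin s ->
    {for t, continuous A12} /\ {for t, continuous A21}) ->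
  forall t, 0 < t < theta -> t \notin s ->
    [/\ {for t, continuous A12}, {for t, continuous A21} &
        is_derive t 1 (z k) (A t *m z k t)].
Proof.
move=> tk sc t tT ts; have [_ _ _ _ xd] := xsol.
have /andP[t_gt0 t_lt] := tT.
have [||c12 c21] := sc t => //; first by rewrite !ltW.
split=> //; apply: is_derive_restart => //.
have shiftc m n (F : R -> 'M[R]_(m, n)) : (forall u, F (u + k%:R * theta) = F u) ->
    {for t, continuous F} -> {for t + k%:R * theta, continuous F}.
  move=> Fper Fc; rewrite /prop_for/= /continuous_at Fper.
  have := @cvg_comp _ _ _ (fun u : R => u - k%:R * theta) F
    (nbhs (t + k%:R * theta)) (nbhs t) (nbhs (F t)).
  rewrite (_ : F \o _ = F); last first.
    by apply/funext => u; rewrite /= -[in RHS](subrK (k%:R * theta) u) Fper.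
  apply=> //.
  have : u - k%:R * theta @[u --> t + k%:R * theta] -->
      t + k%:R * theta - k%:R * theta.
    by apply: cvgB; [exact: cvg_id|exact: cvg_cst].
  by rewrite addrK.
have zE : z k t = x (t + k%:R * theta) by rewrite /z /restart leNgt t_gt0.
rewrite zE /A -(A12_pern t k) -(A21_pern t k); apply: xd.
- by lra.
- exact: (no_impulse (z_shift k tT)).
- by apply: shiftc c12 => u; exact: A12_pern.
- by apply: shiftc c21 => u; exact: A21_pern.
Qed.

Let discontinuities (a b : R) : exists s : seq R, forall t, a <= t <= b ->
  t \notin s -> {for t, continuous A12} /\ {for t, continuous A21}.
Proof.
have [s12 c12] := piecewise_continuous_seq a b A12_pc.
have [s21 c21] := piecewise_continuous_seq a b A21_pc.
exists (s12 ++ s21) => t tab; rewrite mem_cat negb_or => /andP[t12 t21].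
by split; [exact: c12|exact: c21].
Qed.

Let z0 k : z k 0 = B *m x (k%:R * theta).
Proof. by rewrite /z /restart lexx. Qed.

Let z_gt0 k t : 0 < t -> z k t = x (t + k%:R * theta).
Proof. by move=> t_gt0; rewrite /z /restart leNgt t_gt0. Qed.

Let V k := dot (x (k%:R * theta)) (P N *m x (k%:R * theta)).

(** One period multiplies the quadratic form by at most [rho]: the impulse
    contributes [lam], the flow between two impulses the exponential. *)
Let V_step k : t0 <= k%:R * theta -> V k.+1 <= rho * V k.
Proof.
move=> tk; have [s sc] := discontinuities 0 theta.
have := chain (z_within tk) (z_deriv tk sc) (leqnn N).
have -> : N%:R * h = theta by exact: Nh.
have kE : theta + k%:R * theta = k.+1%:R * theta by rewrite -natr1; lra.
rewrite z0 z_gt0// kE => /le_trans; apply.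
rewrite /rho -mulrA ler_wpM2l ?expR_ge0//.
by have := lamP (x (k%:R * theta)); rewrite dot_mulmxl !mulmxA.
Qed.

Let V_iter k j : t0 <= k%:R * theta -> V (k + j) <= rho ^+ j * V k.
Proof.
move=> tk; elim: j => [|j IHj]; first by rewrite addn0 expr0 mul1r.
have tkj : t0 <= (k + j)%:R * theta.
  by apply: le_trans tk _; rewrite ler_pM2r// ler_nat leq_addr.
rewrite addnS exprS -mulrA; apply: le_trans (V_step tkj) _.
by rewrite ler_wpM2l.
Qed.

Variable K : R.
Hypotheses (K_ge0 : 0 <= K) (AK : forall t y, dot y (A t *m y) <= K * dot y y).

Let after_impulse k t : t0 <= k%:R * theta ->
  k%:R * theta < t <= k.+1%:R * theta ->
  dot (x t) (x t) <= expR (2 * K * theta) * opnorm B ^+ 2 *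
    dot (x (k%:R * theta)) (x (k%:R * theta)).
Proof.
move=> tk /andP[kt tk1]; pose r := t - k%:R * theta.
have r0 : 0 < r by rewrite subr_gt0.
have rT : r <= theta by move: tk1; rewrite /r -natr1; lra.
have [s sc] := discontinuities 0 theta.
have zw : {within `[0, r], continuous (z k)}.
  by apply: continuous_subspaceW (z_within tk); apply: subset_itvl; rewrite bnd_simp.
have zd u : 0 < u < r -> u \notin s -> is_derive u 1 (z k) (A u *m z k u).
  move=> /andP[u0 ur] us.
  have uT : 0 < u < theta by rewrite u0 (lt_le_trans ur).
  by have [] := z_deriv tk sc uT us.
have := coarse_growth (ltW r0) zw zd (fun u y _ => AK u y).
rewrite z0 z_gt0// subrK subr0 => /le_trans; apply.
rewrite -[leRHS]mulrA; apply: ler_pM; rewrite ?expR_ge0 ?dotxx_ge0//.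
  by rewrite ler_expR ler_wpM2l// mulr_ge0.
rewrite -!enorm_sqr -exprMn ler_pXn2r ?nnegrE ?enorm_ge0//.
  exact: enorm_mulmx.
by rewrite mulr_ge0 ?opnorm_ge0 ?enorm_ge0.
Qed.

Let before_impulse (b t : R) : (forall r, t0 <= r < b -> ~ impulse_moment theta r) ->
  t0 <= t <= b ->
  dot (x t) (x t) <= expR (2 * K * (b - t0)) * dot x0 x0.
Proof.
move=> imp /andP[tt tb]; have [xE xl _ xr xd] := xsol.
have e1 : expR (2 * K * (t - t0)) <= expR (2 * K * (b - t0)).
  by rewrite ler_expR ler_wpM2l ?mulr_ge0// lerD2r.
apply: le_trans (ler_wpM2r (dotxx_ge0 x0) e1).
move: tt; rewrite le_eqVlt => /predU1P[<-|tt].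
  by rewrite subrr mulr0 expR0 mul1r xE.
have [s sc] := discontinuities t0 t.
have imp0 : ~ impulse_moment theta t0 by apply: imp; rewrite lexx (lt_le_trans tt).
have yw : {within `[t0, t], continuous (restart x t0 0 x0)}.
  apply: restart_within => //.
  - by rewrite addr0 -xE; exact: xr.
  - by move=> u /andP[u0 _]; rewrite addr0; exact: xl.
  - move=> u /andP[u0 ut]; rewrite addr0; apply: xr; first exact: ltW.
    by apply: imp; rewrite ltW//= (lt_le_trans ut).
have yE u : t0 < u -> restart x t0 0 x0 u = x u.
  by move=> u0; rewrite /restart leNgt u0 addr0.
have yd u : t0 < u < t -> u \notin s ->
    is_derive u 1 (restart x t0 0 x0) (A u *m restart x t0 0 x0 u).
  move=> /andP[u0 ut] us; rewrite yE//; apply: is_derive_restart => //.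
  have [|//|c12 c21] := sc u; first by rewrite !ltW.
  by rewrite addr0; apply: xd => //; apply: imp; rewrite ltW//= (lt_le_trans ut).
have := coarse_growth (ltW tt) yw yd (fun u y _ => AK u y).
by rewrite yE// [restart _ _ _ _ t0]/restart lexx.
Qed.

(** The factors are, from right to left: [j] full periods; the growth up to the
    first impulse, at [k theta]; the comparison of the form with the norm at
    [k theta] and at [(k + j) theta]; the last impulse and the flow after it. *)
Lemma solution_decay k j t : (forall i, (i < k)%N -> i%:R * theta < t0) ->
  t0 <= k%:R * theta -> (k + j)%:R * theta < t <= (k + j).+1%:R * theta ->
  dot (x t) (x t) <= expR (2 * K * theta) * opnorm B ^+ 2 *
    (opnorm (P N) / lambda_min (P N)) * expR (2 * K * (k%:R * theta - t0)) *
    rho ^+ j * dot x0 x0.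
Proof.
move=> kmin tk tj; have PN := Pmx_posdef (leqnn N).
have [l0 lP] := lambda_minP (ltn_addr n2 n1_gt0) PN.
have tkj : t0 <= (k + j)%:R * theta.
  by apply: le_trans tk _; rewrite ler_pM2r// ler_nat leq_addr.
apply: le_trans (after_impulse tkj tj) _.
set c := _ * _ ^+ 2; have c0 : 0 <= c by rewrite mulr_ge0 ?expR_ge0 ?sqr_ge0.
have regroup (p l e r d : R) : c * (p / l) * e * r * d = c * (l^-1 * (r * (p * (e * d)))).
  by ring.
rewrite regroup ler_wpM2l// ler_pdivlMl//.
apply: le_trans (lP _) _; apply: le_trans (V_iter j tk) _.
have Vle : V k <= opnorm (P N) * dot (x (k%:R * theta)) (x (k%:R * theta)).
  by rewrite /V -enorm_sqr expr2; exact: dot_mulmx_ler.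
have imp r : t0 <= r < k%:R * theta -> ~ impulse_moment theta r.
  move=> /andP[tr rk] [i rE]; move: tr rk; rewrite rE ltr_pM2r// ltr_nat.
  by move=> ti /kmin; rewrite ltNge ti.
have xk : dot (x (k%:R * theta)) (x (k%:R * theta)) <=
    expR (2 * K * (k%:R * theta - t0)) * dot x0 x0.
  by apply: before_impulse => //; rewrite tk lexx.
have r0 : 0 <= rho ^+ j by rewrite exprn_ge0.
exact: (ler_wpM2l r0 (le_trans Vle (ler_wpM2l (opnorm_ge0 _) xk))).
Qed.

Lemma solution_before k t : (forall i, (i < k)%N -> i%:R * theta < t0) ->
  t0 <= t <= k%:R * theta ->
  dot (x t) (x t) <= expR (2 * K * (k%:R * theta - t0)) * dot x0 x0.
Proof.
move=> kmin tk; apply: before_impulse => // r /andP[tr rk] [i rE].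
move: tr rk; rewrite rE ltr_pM2r// ltr_nat => ti /kmin; by rewrite ltNge ti.
Qed.

End Solution.

Let first_impulse (t0 : R) : exists k,
  t0 <= k%:R * theta /\ forall i, (i < k)%N -> i%:R * theta < t0.
Proof.
have ex := moment_unbounded t0.
exists (ex_minn ex); case: ex_minnP => k tk kmin; split=> // i ik.
by rewrite ltNge; apply/negP => /kmin; rewrite leqNgt ik.
Qed.

Theorem impulsive_asymptotically_stable : asymptotically_stable sol.
Proof.
have [K K0 AK] := growth_bound.
have PN := Pmx_posdef (leqnn N).
have [l0 _] := lambda_minP (ltn_addr n2 n1_gt0) PN.
pose C k t0 := expR (2 * K * theta) * opnorm B ^+ 2 *
    (opnorm (P N) / lambda_min (P N)) * expR (2 * K * (k%:R * theta - t0)).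
pose E k t0 := expR (2 * K * (k%:R * theta - t0)).
have C0 k t0 : 0 <= C k t0.
  rewrite mulr_ge0 ?expR_ge0// mulr_ge0//.
    by rewrite mulr_ge0 ?expR_ge0 ?sqr_ge0.
  by rewrite mulr_ge0 ?opnorm_ge0// invr_ge0 ltW.
have interval k t : k%:R * theta < t -> exists j,
    (k + j)%:R * theta < t <= (k + j).+1%:R * theta.
  move=> kt; have [n tn] := moment_unbounded (t - k%:R * theta).
  have [|j _ /andP[jt tj]] := @interval_index theta (t - k%:R * theta) n.
    by rewrite subr_gt0 kt.
  by exists j; rewrite -addnS !natrD; lra.
split.
- move=> eps t0 eps0; have [k [tk kmin]] := first_impulse t0.
  (* [E] serves up to the first impulse, [C] after it. *)
  pose D := C k t0 + E k t0.
  have D0 : 0 < D by rewrite ltr_wpDl ?expR_gt0.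
  have sD0 : 0 < Num.sqrt D by rewrite sqrtr_gt0.
  exists (eps / Num.sqrt D); first by rewrite divr_gt0.
  move=> x0 x xsol; rewrite ltr_pdivlMr// => x0D t tt.
  apply: le_lt_trans x0D; rewrite !enormE mulrC -sqrtrM ?(ltW D0)//.
  apply: ler_wsqrtr; rewrite mulrDl.
  have X0 := dotxx_ge0 x0.
  have CX : 0 <= C k t0 * dot x0 x0 by rewrite mulr_ge0.
  have EX : 0 <= E k t0 * dot x0 x0 by rewrite mulr_ge0 ?expR_ge0.
  have [tle|tgt] := leP t (k%:R * theta).
    apply: (@le_trans _ _ (E k t0 * dot x0 x0)); last by rewrite lerDr.
    by apply: (solution_before xsol K0 AK kmin); rewrite tt.
  have [j tj] := interval k t tgt.
  apply: (@le_trans _ _ (C k t0 * dot x0 x0)); last by rewrite lerDl.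
  apply: le_trans (solution_decay xsol K0 AK kmin tk tj) _.
  rewrite ler_wpM2r// -/(C k t0) -[leRHS]mulr1 ler_wpM2l//.
  by apply: exprn_ile1 => //; exact: ltW.
- move=> t0 x0 x xsol; have [k [tk kmin]] := first_impulse t0.
  have : (C k t0 * dot x0 x0) * rho ^+ j @[j --> \oo] --> (C k t0 * dot x0 x0) * 0.
    by apply: cvgM; [exact: cvg_cst|apply: cvg_expr; rewrite ger0_norm].
  rewrite mulr0 => /cvgrPdist_lt Crho; apply/cvgrPdist_lt => eps eps0.
  have e2 : 0 < eps ^+ 2 by rewrite exprn_gt0.
  have [j0 _ jP] := Crho _ e2.
  exists ((k + j0)%:R * theta); split; first exact: num_real.
  move=> t tt; rewrite sub0r normrN ger0_norm ?enorm_ge0//.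
  have kt : k%:R * theta < t.
    by apply: le_lt_trans tt; rewrite ler_pM2r// ler_nat leq_addr.
  have [j tj] := interval k t kt.
  have jj : (j0 <= j)%N.
    have /andP[_ tj1] := tj; have := lt_le_trans tt tj1.
    by rewrite ltr_pM2r// ltr_nat ltnS leq_add2l.
  rewrite -(@ltr_pXn2r _ 2) ?nnegrE ?enorm_ge0 ?(ltW eps0)// enorm_sqr.
  apply: le_lt_trans (solution_decay xsol K0 AK kmin tk tj) _.
  have := jP _ jj; rewrite /= sub0r normrN => /(le_lt_trans (ler_norm _)).
  by rewrite mulrAC.
Qed.

End Stability.

Theorem theorem4p1 (R : realType) (n1 n2 : nat)
    (n1_gt0 : (0 < n1)%N) (n2_gt0 : (0 < n2)%N)
    (A11 : 'M[R]_n1) (A12 : R -> 'M[R]_(n1, n2))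
    (A21 : R -> 'M[R]_(n2, n1)) (A22 : 'M[R]_n2)
    (B11 : 'M[R]_n1) (B12 : 'M[R]_(n1, n2))
    (B21 : 'M[R]_(n2, n1)) (B22 : 'M[R]_n2)
    (theta : R) (theta_gt0 : 0 < theta)
    (A12_pc : piecewise_continuous A12) (A21_pc : piecewise_continuous A21)
    (A12_per : forall t : R, A12 (t + theta) = A12 t)
    (A21_per : forall t : R, A21 (t + theta) = A21 t)
    (mu1 mu2 delta1 delta2 M1 M2 N1 N2 : R)
    (expA11 : forall s : R, 0 <= s -> opnorm (expmx (s *: A11)) <= M1 * expR (s * mu1))
    (expA22 : forall s : R, 0 <= s -> opnorm (expmx (s *: A22)) <= M2 * expR (s * mu2))
    (expNA11 : forall s : R, 0 <= s ->
       opnorm (expmx (- (s *: A11))) <= N1 * expR (s * delta1))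
    (expNA22 : forall s : R, 0 <= s ->
       opnorm (expmx (- (s *: A22))) <= N2 * expR (s * delta2))
    (mu1_neq0 : mu1 != 0) (mu2_neq0 : mu2 != 0)
    (delta1_neq0 : delta1 != 0) (delta2_neq0 : delta2 != 0)
    (mu2_delta1_neq0 : mu2 + delta1 != 0) (mu1_delta2_neq0 : mu1 + delta2 != 0)
    (N : nat) (N_gt0 : (0 < N)%N)
    (gamma12 gamma21 : nat -> R)
    (gamma12_gt0 : forall m, (m < N)%N -> 0 < gamma12 m)
    (gamma21_gt0 : forall m, (m < N)%N -> 0 < gamma21 m)
    (P0 : 'M[R]_(n1 + n2)) (P0_posdef : posdefmx P0) :
  let h := theta / N%:R in
  let B := block_mx B11 B12 B21 B22 in
  let P := Pmx A11 A12 A21 A22 h P0 in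
  let Pi m := Pimx h (gamma12 m) (gamma21 m) (P m) in
  let Th m := Theta A11 A22 mu1 mu2 delta1 delta2 M1 M2 N1 N2 h
                (gamma12 m) (gamma21 m) (P m) in
  (forall m, (m < N)%N ->
     (ereal_sup [set (opnorm (A12 s))%:E | s in [set s : R | (m%:R * h < s <= m.+1%:R * h)%R]]
        <= (gamma12 m)%:E)%E) ->
  (forall m, (m < N)%N ->
     (ereal_sup [set (opnorm (A21 s))%:E | s in [set s : R | (m%:R * h < s <= m.+1%:R * h)%R]]
        <= (gamma21 m)%:E)%E) ->
  (forall m, (m < N)%N -> posdefmx (Pi m)) ->
  (* [lne] is the extended logarithm, with value [-oo] at [0], which is
     reached when [B = 0] *)
  ((\sum_(m < N) Th m / lambda_min (Pi m))%:E +
     lne (lambda_max (invmx (P N) *m B^T *m P0 *m B))%:E < 0)%E ->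
  asymptotically_stable (impulsive_solution A11 A12 A21 A22 B theta).
Proof.
move=> h B P Pi Th A12_sup A21_sup Pi_posdef Q_lt0.
have sup_le m n (F : R -> 'M[R]_(m, n)) i (g : R) :
    (ereal_sup [set (opnorm (F s))%:E | s in
      [set s : R | (i%:R * h < s <= i.+1%:R * h)%R]] <= g%:E)%E ->
    forall t, i%:R * h < t <= i.+1%:R * h -> opnorm (F t) <= g.
  move=> supF t tin; rewrite -lee_fin; apply: le_trans supF.
  by apply: ereal_sup_ubound; exists t.
pose lmax := lambda_max (invmx (P N) *m B^T *m P0 *m B).
have PN_posdef : posdefmx (P N).
  apply: (@Pmx_posdef _ _ _ A11 A12 A21 A22 theta N _ _ _ _ gamma12 gamma21) => //.
  - by move=> m t mN; exact: sup_le (A12_sup m mN) t.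
  - by move=> m t mN; exact: sup_le (A21_sup m mN) t.
(* The maximum with [0] covers the case where the extended logarithm is [-oo]. *)
apply: (@impulsive_asymptotically_stable _ _ _ n1_gt0 _ _ _ _ B theta N theta_gt0 N_gt0
  A12_pc A21_pc A12_per A21_per _ _ _ _ _ _ _ _ expA11 expA22 expNA11 expNA22
  mu1_neq0 mu2_neq0 delta1_neq0 delta2_neq0 mu2_delta1_neq0 mu1_delta2_neq0
  gamma12 gamma21 P0 gamma12_gt0 gamma21_gt0 P0_posdef _ _ _ (Num.max lmax 0)).
- by move=> m t mN; exact: sup_le (A12_sup m mN) t.
- by move=> m t mN; exact: sup_le (A21_sup m mN) t.
- exact: Pi_posdef.
- move=> x; have BPB_sym : (B^T *m P0 *m B)^T = B^T *m P0 *m B.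
    by rewrite !trmx_mul trmxK P0_posdef.1 mulmxA.
  have := lambda_maxP (ltn_addr n2 n1_gt0) PN_posdef BPB_sym x.
  rewrite !mulmxA -/lmax => /le_trans; apply.
  apply: ler_wpM2r; last by rewrite le_max lexx.
  have [->|x0] := eqVneq x 0; first by rewrite mulmx0 dot0r.
  exact/ltW/posdefmx_dot.
- by rewrite le_max lexx orbT.
- have [l0|l0] := leP lmax 0; first by rewrite mulr0.
  move: Q_lt0; rewrite -/lmax lne_EFin// -EFinD lte_fin => Q_lt0.
  by rewrite -[X in _ * X](lnK l0) -expRD expR_lt1.
Qed.
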